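(* Let $d\ge 1$ be an integer and $c\in\mathbb{R}$. Assume that the coupled system with $d$ second class particles is stationary and $\underline{\xi}\sim\underline{\mu}^c$. For a given $m\in\mathbb{Z}$, there is a second class particle at site $m$ with probability $$\mathbb{P}(\xi_m>\eta_m)=\frac{(1-q^d)\,q^{c-m}}{(1+q^{c-m})(1+q^{c+d-m})}.$$
   Context: Fix $q\in(0,1)$. For $c\in\mathbb{R}$, $\underline{\mu}^c$ is the product probability measure on $\{0,1\}^{\mathbb{Z}}$ under which the coordinates $z_i$ are independent with $\underline\mu^c(z_i=1)=\frac{q^{c-i}}{1+q^{c-i}}$. It is concentrated on the countable set $\Omega=\{\underline z\in\{0,1\}^{\mathbb{Z}}:\sum_{i\le0}z_i<\infty,\ \sum_{i\ge1}(1-z_i)<\infty\}$. ASEP: the Markov jump process $\underline\xi(t)$ on $\Omega$ in which, for every $i\in\mathbb{Z}$, a particle at $i$ jumps to $i+1$ at rate $1$ if $i+1$ is empty, and a particle at $i+1$ jumps to $i$ at rate $q$ if $i$ is empty. The label of a particle of $\underline\xi(t)$ is the number of particles of $\underline\xi(t)$ strictly to its left; labels are $0,1,2,\dots$. Coupled system with $d$ second class particles: let $Z_+^d=\{\underline x\in\mathbb{Z}^d:0\le x_1<\dots<x_d\}$. It is the Markov process $(\underline\xi(t),\underline x(t))$ on $\Omega\times Z_+^d$ in which $\underline\xi(t)$ evolves as ASEP, and the label process $\underline x(t)$ evolves as follows: each coordinate $x_j$ becomes $x_j+1$ at rate $q$ if $x_j+1$ is not one of the coordinates of $\underline x$, and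 becomes $x_j-1$ at rate $1$ if $x_j-1\ge0$ and $x_j-1$ is not one of the coordinates; in either case the move is allowed only if the two particles of $\underline\xi(t)$ whose labels are the old and new values of $x_j$ occupy neighbouring sites. Let $X_j(t)$ be the site of the particle of $\underline\xi(t)$ with label $x_j(t)$; $X_1(t)<\dots<X_d(t)$ are the positions of the second class particles. Put $\underline\eta(t)=\underline\xi(t)-\sum_{j=1}^d\underline\delta_{X_j(t)}$, where $\underline\delta_i$ is the configuration with a single particle, at site $i$. (Then $(\underline\eta,\underline\xi)$ is a basic coupling of two ASEPs.) The coupled system is stationary if the law of $(\underline\xi(t),\underline x(t))$ does not depend on $t$; $\underline\xi,\underline\eta,\underline x,\underline X$ denote the values at a fixed time. *)

(* Defs.v *)
From HB Require Import structures.
From mathcomp Require Import all_boot all_order all_algebra.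
From mathcomp Require Import finmap.
From mathcomp Require Import all_classical all_reals all_analysis.

Set Implicit Arguments.
Unset Strict Implicit.
Unset Printing Implicit Defensive.

Import Order.TTheory GRing.Theory Num.Theory.
Import numFieldNormedType.Exports.

Local Open Scope classical_set_scope.
Local Open Scope ring_scope.

Section MarkovJumpProcess.
Context {R : realType} {E : choiceType}.
Implicit Types (rate : E -> E -> R) (p : R -> E -> E -> R).

Definition transition_function p : Prop :=
  [/\ forall (t : R) s s', 0 <= t -> 0 <= p t s s',
      forall (t : R) s, 0 <= t -> (\esum_(s' in [set: E]) (p t s s')%:E = 1)%E,
      forall s s', p 0 s s' = (s == s')%:R
    & forall (t u : R) s s', 0 <= t -> 0 <= u ->
        ((p (t + u) s s')%:E =
         \esum_(r in [set: E]) (p t s r * p u r s')%:E)%E].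

(* p_h(s, s') = rate s s' * h + o(h) for s != s', and 1 - p_h(s, s) is h times
   the total exit rate of s, up to o(h), as h decreases to 0; the diagonal
   values of [rate] are not used. *)
Definition has_jump_rates rate p : Prop :=
  (forall s s', s != s' -> p h s s' / h @[h --> 0^'+] --> rate s s') /\
  (forall s, (((1 - p h s s) / h)%:E @[h --> 0^'+] -->
     \esum_(s' in [set~ s]) (rate s s')%:E)%E).

(* The state space E is meant to be countable and carries the discrete
   sigma-algebra and topology. *)
Record markov_jump_process rate (d : measure_display) (T : measurableType d)
    (P : probability T R) (S : R -> T -> E) : Prop := MarkovJumpProcess {
  mjp_measurable : forall (t : R) (A : set E), 0 <= t -> measurable (S t @^-1` A) ;
  mjp_right_continuous : {ae P, forall w, forall t : R, 0 <= t ->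
    \forall u \near t^'+, S u w = S t w} ;
  mjp_markov : exists p : R -> E -> E -> R,
    [/\ transition_function p, has_jump_rates rate p
      & forall (n : nat) (t : nat -> R) (s : nat -> E),
          0 <= t 0%N -> (forall k, t k <= t k.+1) ->
          (P [set w | forall k, (k <= n.+1)%N -> S (t k) w = s k] =
           P [set w | forall k, (k <= n)%N -> S (t k) w = s k] *
           (p (t n.+1 - t n) (s n) (s n.+1))%:E)%E] }.

Definition stationary (d : measure_display) (T : measurableType d)
    (P : probability T R) (S : R -> T -> E) : Prop :=
  forall (t u : R) (A : set E), 0 <= t -> 0 <= u ->
    P (S t @^-1` A) = P (S u @^-1` A).

End MarkovJumpProcess.

Definition Omega : set (int -> bool) :=
  [set z : int -> bool |
     finite_set [set i : int | i <= 0 /\ z i] /\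
     finite_set [set i : int | 1 <= i /\ ~~ z i]].

Definition Zplus (d : nat) : set {ffun 'I_d -> nat} :=
  [set x : {ffun 'I_d -> nat} | forall i j : 'I_d, (i < j)%N -> (x i < x j)%N].

Arguments Zplus d : clear implicits.

Definition coupled_state (d : nat) : choiceType := (Omega * Zplus d)%type.

Definition occ (xi : Omega) (i : int) : bool := val xi i.

Definition crd (d : nat) (x : Zplus d) (j : 'I_d) : nat := val x j.

(* xi ~ mu^c: the coordinates of the random configuration xi are independent
   (first conjunct), with the prescribed marginals (second conjunct). *)
Definition blocking_law {R : realType} (q c : R) (d : measure_display)
    (T : measurableType d) (P : probability T R) (xi : T -> Omega) : Prop :=
  (forall (J : {fset int}) (B : int -> set bool),
     (P [set w | forall i, i \in J -> B i (occ (xi w) i)] =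
      \prod_(i <- J) P [set w | B i (occ (xi w) i)])%E) /\
  (forall i : int,
     P [set w | occ (xi w) i] =
     (q `^ (c - i%:~R) / (1 + q `^ (c - i%:~R)))%:E).

Definition particle_jump (z z' : Omega) (i j : int) : Prop :=
  [/\ occ z i, ~~ occ z j &
      forall k, occ z' k = if k == i then false
                           else if k == j then true else occ z k].

(* Distinct sites i give distinct targets z', and no z' is reached both by a
   jump to the right and by a jump to the left, so that no rates add up. *)
Definition asep_rate {R : realType} (q : R) (z z' : Omega) : R :=
  `[< exists i, particle_jump z z' i (i + 1) >]%:R +
  q * `[< exists i, particle_jump z z' (i + 1) i >]%:R.

(* The set is finite for z in Omega. *)
Definition label (z : Omega) (i : int) : nat :=
  #|` fset_set [set k : int | k < i /\ occ z k] |.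

(* On Omega every natural number is the label of exactly one particle, so the
   default value 0 of [xget] is never used. *)
Definition site (z : Omega) (l : nat) : int :=
  xget 0 [set i : int | occ z i /\ label z i = l].

Definition label_jump (d : nat) (z : Omega) (x x' : Zplus d) (k l : nat) :
    Prop :=
  `|site z l - site z k| = 1 /\
  exists j : 'I_d,
    [/\ crd x j = k, forall i, crd x i != l &
        forall i, crd x' i = if i == j then l else crd x i].

Definition label_rate {R : realType} (q : R) (d : nat) (z : Omega)
    (x x' : Zplus d) : R :=
  q * `[< exists k, label_jump z x x' k k.+1 >]%:R +
  `[< exists k, label_jump z x x' k.+1 k >]%:R.

Definition coupled_rate {R : realType} (q : R) (d : nat)
    (s s' : coupled_state d) : R :=
  (s'.2 == s.2)%:R * asep_rate q s.1 s'.1 +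
  (s'.1 == s.1)%:R * label_rate q s.1 s.2 s'.2.

Definition xi_at (d : nat) (s : coupled_state d) (i : int) : int :=
  (occ s.1 i)%:Z.

Definition eta_at (d : nat) (s : coupled_state d) (i : int) : int :=
  xi_at s i - \sum_(j < d) (i == site s.1 (crd s.2 j))%:Z.

(* Main.v *)
Require Import Defs.
From HB Require Import structures.
From mathcomp Require Import all_boot all_order all_algebra.
From mathcomp Require Import finmap.
From mathcomp Require Import all_classical all_reals all_analysis.
From mathcomp Require Import zify ring lra.

Set Implicit Arguments.
Unset Strict Implicit.
Unset Printing Implicit Defensive.

Import Order.TTheory GRing.Theory Num.Theory.
Import numFieldNormedType.Exports.
Local Open Scope classical_set_scope.
Local Open Scope ring_scope.

(** Write [pi] for the law of the pair (configuration, labels) at time [t].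
    The measure [lam (z, x) = mu^c(z) q^(x_1 + ... + x_d)] is reversible for the
    coupled rates and its total flow is finite, because only finitely many jumps
    are possible on average under [mu^c].  Stationarity gives, after letting the
    time step decrease to 0, that [pi / lam] is superharmonic; testing this
    against the bounded concave function [u / (1 + u)] and summing over all
    states forces [pi / lam] to take the same value at both ends of every
    allowed transition.  Since two consecutive particles can be brought together
    by ASEP jumps, [pi / lam] does not depend on the labels, so that [pi] is the
    product of [mu^c] and the law proportional to [q^(x_1 + ... + x_d)].

    It remains to average, over [mu^c], the probability that the label of a
    particle at [m] is one of the [x_j].  With [e d] the sum of the weights
    [q^(sum A)] over the [d]-subsets [A] of the naturals and [b d k] its part
    from the [A] containing [k], one has [b (d+1) k + q^k b d k = q^k e d], so
    an induction on [d] reduces everything to the moments [E (q^r)^label],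
    which are telescoping products. *)

(** * Sums of nonnegative families and reversible weights *)

Section esum_complements.
Context {R : realType}.
Local Open Scope ereal_scope.

Lemma esumZl (T : choiceType) (I : set T) (c : R) (a : T -> \bar R) :
  (0 <= c)%R -> (forall i, 0 <= a i) ->
  \esum_(i in I) (c%:E * a i) = c%:E * \esum_(i in I) a i.
Proof.
move=> c0 a0; rewrite /esum -ereal_supZl//; last first.
  apply/set0P; exists (\sum_(x \in set0) a x); exists set0 => //.
  exact: fsets_set0.
congr ereal_sup; rewrite image_comp.
by apply: eq_imagel => A _ /=; rewrite ge0_mule_fsumr.
Qed.

Lemma esum_le_seq (T : choiceType) (I : set T) (a : T -> \bar R) (M : \bar R) :
  (forall s : seq T, uniq s -> (forall i, i \in s -> I i) ->
     \sum_(i <- s) a i <= M) ->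
  \esum_(i in I) a i <= M.
Proof.
move=> h; apply: ge_ereal_sup => _ [A [Af AI] <-]; rewrite fsbig_finite//=.
apply: h; first exact: fset_uniq.
by move=> i; rewrite in_fset_set// inE => /AI.
Qed.

Lemma esum_ge_seq (T : choiceType) (I : set T) (a : T -> \bar R) (s : seq T) :
  uniq s -> (forall i, i \in s -> I i) ->
  \sum_(i <- s) a i <= \esum_(i in I) a i.
Proof.
move=> us sI; apply: esum_ge; exists [set` s]; last by rewrite fsbig_seq.
by split => //; exact: finite_seq.
Qed.

Lemma esum_ge_term (T : choiceType) (I : set T) (a : T -> \bar R) (i : T) :
  I i -> a i <= \esum_(i in I) a i.
Proof.
move=> Ii; rewrite -[leLHS](big_seq1 +%E i a); apply: esum_ge_seq => // j.
by rewrite inE => /eqP ->.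
Qed.

(** Serves to bound exit rates: a move of a given kind from a given state has at most one target. *)
Lemma esum_le1 (T : choiceType) (I : set T) (U : T -> Prop) :
  (forall i j, U i -> U j -> i = j) ->
  \esum_(i in I) (`[< U i >]%:R)%:E <= 1 :> \bar R.
Proof.
move=> Uu; apply: esum_le_seq => s us _.
elim: s us => [|i s IH] /=; first by rewrite big_nil.
case/andP => is_ us; rewrite big_cons; case: asboolP => [Ui|_]; last first.
  by rewrite add0e IH.
rewrite big_seq big1 ?adde0// => j js; case: asboolP => // Uj.
by move: is_; rewrite (Uu i j)// js.
Qed.

Lemma esum_exchange (T1 T2 : choiceType) (I : set T1) (J : set T2)
    (a : T1 -> T2 -> \bar R) :
  (forall i j, 0 <= a i j) ->
  \esum_(i in I) \esum_(j in J) a i j = \esum_(j in J) \esum_(i in I) a i j.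
Proof.
move=> a0; rewrite esum_esum// [RHS]esum_esum//.
rewrite (reindex_esum (J `*` I) _ (fun x => (x.2, x.1)))//; split=> //=.
- by move=> [i j] [/=].
- by move=> [i1 i2] [j1 j2] /= _ _ [-> ->].
- by move=> [i1 i2] [? ?] /=; exists (i2, i1).
Qed.

Lemma esum_pair (T1 T2 : choiceType) (a : T1 * T2 -> \bar R) :
  (forall i, 0 <= a i) ->
  \esum_(i in setT) a i = \esum_(i in setT) \esum_(j in setT) a (i, j).
Proof.
move=> a0; rewrite esum_esum//.
rewrite (_ : setT `*`` _ = setT); first by apply: eq_esum => -[].
by apply/seteqP; split.
Qed.

(** The index 0 occurs in both series, whence only an inequality. *)
Lemma esum_int_le (a : int -> \bar R) : (forall i, 0 <= a i) ->
  \esum_(i in setT) a i <=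
  \esum_(n in [set: nat]) a n + \esum_(n in [set: nat]) a (- n%:Z)%R.
Proof.
move=> a0; rewrite (esumID (range Posz))// !setTI.
rewrite esum_image; last by move=> x y _ _ [].
rewrite leeD2l// [leRHS](esumID (range S))// !setTI.
rewrite esum_image; last by move=> x y _ _ [].
rewrite (_ : ~` range Posz = range Negz); last first.
  apply/seteqP; split=> [[n|n] /= h|_ [n _ <-] [k _]//]; last by exists n.
  by case: h; exists n.
rewrite esum_image; last by move=> x y _ _ [].
by rewrite leeDl// esum_ge0.
Qed.

End esum_complements.

(** * Superharmonic functions for a symmetric flow of finite total *)

Section reversible.
Context {R : realType} {E : choiceType}.
Variables (w : E -> E -> R) (f : E -> R).
Hypothesis w_ge0 : forall s s', 0 <= w s s'.
Hypothesis w_sym : forall s s', w s s' = w s' s.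
Hypothesis w_fin : (\esum_(s in setT) \esum_(s' in setT) (w s s')%:E < +oo)%E.
Hypothesis f_ge0 : forall s, 0 <= f s.
Hypothesis f_super : forall s,
  (\esum_(s' in setT) (w s s' * f s')%:E <=
   (f s)%:E * \esum_(s' in setT) (w s s')%:E)%E.

(** Being bounded, [phi] gives finite sums even where [f] is not summable against [w]; being
    strictly concave, it detects every difference of values. *)
Let phi (x : R) := x / (1 + x).
Let D (x y : R) := (y - x) ^+ 2 / ((1 + x) ^+ 2 * (1 + y)).

Let phi_ge0 x : 0 <= x -> 0 <= phi x.
Proof. by move=> x0; rewrite /phi divr_ge0// addr_ge0. Qed.

Let phi_le1 x : 0 <= x -> phi x <= 1.
Proof. by move=> x0; rewrite /phi ler_pdivrMr ?mul1r ?lerDr// ltr_pwDl. Qed.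

Let D_ge0 x y : 0 <= x -> 0 <= y -> 0 <= D x y.
Proof.
by move=> x0 y0; rewrite divr_ge0 ?sqr_ge0// mulr_ge0 ?sqr_ge0 ?addr_ge0.
Qed.

(* The tangent of the concave function [phi] at [x] lies above its graph, the
   gap at [y] being [D x y]. *)
Let phi_tangent x y : 0 <= x -> 0 <= y ->
  D x y + phi y + x / (1 + x) ^+ 2 = phi x + y / (1 + x) ^+ 2.
Proof. by move=> x0 y0; rewrite /D /phi; field; lra. Qed.

Let row_fin s : (\esum_(s' in setT) (w s s')%:E)%E \is a fin_num.
Proof.
rewrite ge0_fin_numE; last by apply: esum_ge0 => *; rewrite lee_fin.
apply: le_lt_trans w_fin.
by apply: (esum_ge_term (fun s => \esum_(s' in setT) (w s s')%:E)%E).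
Qed.

(** The tangent identity at [f s], multiplied by [w s s'] and summed over [s']; superharmonicity
    makes the linear part nonpositive. The terms are kept additive because the linear part is
    cancelled in the extended reals, once it is known to be finite. *)
Let row_le s :
  (\esum_(s' in setT) (w s s' * D (f s) (f s'))%:E +
   \esum_(s' in setT) (w s s' * phi (f s'))%:E <=
   \esum_(s' in setT) (w s s' * phi (f s))%:E)%E.
Proof.
(* The slope of [phi] at [f s]. *)
pose c := ((1 + f s) ^+ 2)^-1.
have c0 : 0 <= c by rewrite invr_ge0 sqr_ge0.
have wD s' : 0 <= w s s' * D (f s) (f s') by rewrite mulr_ge0// D_ge0.
have wp x s' : 0 <= w s s' * phi (f x) by rewrite mulr_ge0// phi_ge0.
have wc s' : 0 <= c * (w s s' * f s') by rewrite !mulr_ge0.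
have wf s' : 0 <= c * (f s * w s s') by rewrite !mulr_ge0.
have fE : (\esum_(s' in setT) (c * (f s * w s s'))%:E =
           c%:E * ((f s)%:E * \esum_(s' in setT) (w s s')%:E))%E.
  under eq_esum do rewrite !EFinM.
  by rewrite !esumZl// => i; rewrite ?mule_ge0// lee_fin.
have : (\esum_(s' in setT) (w s s' * D (f s) (f s'))%:E +
   \esum_(s' in setT) (w s s' * phi (f s'))%:E +
   \esum_(s' in setT) (c * (f s * w s s'))%:E =
   \esum_(s' in setT) (w s s' * phi (f s))%:E +
   \esum_(s' in setT) (c * (w s s' * f s'))%:E)%E.
  rewrite -!esumD//; try by move=> *; rewrite -?EFinD lee_fin ?addr_ge0.
  apply: eq_esum => s' _; rewrite -!EFinD; congr _%:E.
  have := phi_tangent (f_ge0 s) (f_ge0 s'); rewrite -/c.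
  by move=> /(congr1 (fun z => w s s' * z)); lra.
have F : (\esum_(s' in setT) (c * (f s * w s s'))%:E)%E \is a fin_num.
  by rewrite fE fin_numM// fin_numM.
move=> e; rewrite -(leeD2rE _ _ F) e leeD2l// fE.
under eq_esum do rewrite EFinM.
rewrite esumZl//; last by move=> *; rewrite lee_fin mulr_ge0.
by apply: lee_wpmul2l; rewrite ?lee_fin.
Qed.

(** Summed over all rows, the two [phi] sums coincide by symmetry of [w] and are finite, so they
    cancel. The nonnegative gaps [D], weighted by [w], then have sum at most 0; each is 0 where [w]
    is positive, and [D] vanishes only on the diagonal. *)
Lemma superharmonic_const s s' : 0 < w s s' -> f s = f s'.
Proof.
move=> wpos.
pose A := (\esum_(x in setT) \esum_(y in setT) (w x y * phi (f x))%:E)%E.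
have wp x y z : 0 <= w x y * phi (f z) by rewrite mulr_ge0// phi_ge0.
have wD x y : 0 <= w x y * D (f x) (f y) by rewrite mulr_ge0// D_ge0.
have A' : A = (\esum_(x in setT) \esum_(y in setT) (w x y * phi (f y))%:E)%E.
  rewrite esum_exchange; last by move=> *; rewrite lee_fin.
  by apply: eq_esum => x _; apply: eq_esum => y _; rewrite w_sym.
have Afin : A \is a fin_num.
  rewrite ge0_fin_numE; last first.
    by apply: esum_ge0 => *; apply: esum_ge0 => *; rewrite lee_fin.
  apply: le_lt_trans w_fin; apply: le_esum => x _; apply: le_esum => y _.
  by rewrite lee_fin ler_piMr// phi_le1.
have DE : (\esum_(x in setT) \esum_(y in setT)
    (w x y * D (f x) (f y))%:E <= 0)%E.
  rewrite -(leeD2rE _ _ Afin) add0e {1}A' -esumD.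
  - by apply: le_esum => x _; exact: row_le.
  - by move=> *; apply: esum_ge0 => *; rewrite lee_fin.
  - by move=> *; apply: esum_ge0 => *; rewrite lee_fin.
have : w s s' * D (f s) (f s') <= 0.
  rewrite -lee_fin; apply: le_trans DE.
  apply: le_trans; last first.
    apply: (esum_ge_term
      (fun x => \esum_(y in setT) (w x y * D (f x) (f y))%:E)%E (i:=s)).
  done.
  by apply: (esum_ge_term (fun y => (w s y * D (f s) (f y))%:E)%E (i:=s')).
rewrite pmulr_rle0// => D0; apply/eqP; rewrite eq_sym -subr_eq0 -sqrf_eq0.
have : D (f s) (f s') == 0 by rewrite eq_le D0 D_ge0.
rewrite mulf_eq0 => /orP[//|]; rewrite invr_eq0 mulf_eq0 !sqrf_eq0.
by have := f_ge0 s; have := f_ge0 s' => ? ? /orP[|] /eqP h; exfalso; lra.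
Qed.

End reversible.

(** * Stationary jump processes *)

Section stationary_law.
Context {R : realType} {E : choiceType} (rate : E -> E -> R).
Context {disp : measure_display} {T : measurableType disp}.
Variables (P : probability T R) (S : R -> T -> E).
Hypothesis hS : markov_jump_process rate P S.
Hypothesis S_stationary : stationary P S.
Variables (t : R) (t_ge0 : 0 <= t).

Definition point_mass (s : E) : R := fine (P (S t @^-1` [set s])).

Lemma state_measurable (A : set E) : measurable (S t @^-1` A).
Proof. exact: (mjp_measurable hS A t_ge0). Qed.

Lemma point_massE s : (point_mass s)%:E = P (S t @^-1` [set s]).
Proof. by rewrite fineK// fin_num_measure//; exact: state_measurable. Qed.

Lemma point_mass_ge0 s : 0 <= point_mass s.
Proof. by rewrite fine_ge0. Qed.

Lemma prob_two_times : exists p : R -> E -> E -> R,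
  [/\ transition_function p, has_jump_rates rate p &
    forall (h : R) s s', 0 <= h ->
      P (S t @^-1` [set s] `&` S (t + h) @^-1` [set s']) =
      (point_mass s * p h s s')%:E].
Proof.
have [p [ptf prate pM]] := mjp_markov hS; exists p; split => // h s s' h0.
(* The Markov property is stated for infinite nondecreasing sequences of times; an arithmetic
   progression extends the two times [t] and [t + h]. *)
have := pM 0%N (fun k => t + k%:R * h) (fun k => if k is 0%N then s else s').
rewrite /= mul0r addr0 mul1r addrAC subrr add0r => /(_ t_ge0) H.
rewrite EFinM point_massE.
rewrite (_ : S t @^-1` _ `&` _ = [set w | forall k, (k <= 1)%N ->
   S (t + k%:R * h) w = if k is 0%N then s else s']); last first.
  apply/seteqP; split => [w /= [h1 h2] [|[|]]//|w /= hw].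
    by rewrite mul0r addr0.
    by rewrite mul1r.
  split; first by have := hw 0%N isT; rewrite mul0r addr0.
  by have := hw 1%N isT; rewrite mul1r.
rewrite H; last by move=> k; rewrite lerD2l ler_wpM2r// ler_nat.
congr (P _ * _)%E; apply/seteqP; split => [w /= hw|w /= hw [|]//].
  by have := hw 0%N isT; rewrite mul0r addr0.
by rewrite mul0r addr0.
Qed.

(* Restricting the flow balance over [t, t + h] to finitely many sources and
   letting h decrease to 0 only yields an inequality. *)
Lemma point_mass_subinvariant s' :
  (\esum_(s in [set~ s']) (point_mass s * rate s s')%:E <=
   (point_mass s')%:E * \esum_(s in [set~ s']) (rate s' s)%:E)%E.
Proof.
have [p [ptf [prate pexit] pM]] := prob_two_times.
apply: esum_le_seq => F uF Fs'.
(* For [s] in [s' :: F], the events of going from [s] to [s'] are disjoint parts of the event of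
   being in [s'] at time [t + h], whose probability is that at time [t] by stationarity. The term
   [s = s'] is then moved to the right. *)
have finite_time h : 0 < h ->
    (\sum_(s <- F) (point_mass s * (p h s s' / h))%:E <=
     (point_mass s')%:E * ((1 - p h s' s') / h)%:E)%E.
  move=> h0; have hge0 := ltW h0.
  have : (\sum_(s <- s' :: F) (point_mass s * p h s s')%:E <=
          (point_mass s')%:E)%E.
    under eq_bigr do rewrite -pM//.
    rewrite point_massE (S_stationary [set s'] t_ge0 (addr_ge0 t_ge0 hge0)).
    have us : uniq (s' :: F).
      by rewrite /= uF andbT; apply/negP => /Fs' /(_ erefl).
    rewrite fsbig_seq// -(measure_fin_bigcup P).
    - apply: le_measure; rewrite ?inE.
      + apply: fin_bigcup_measurable => // s _.
        exact: (measurableI _ _ (state_measurable _)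
                 (mjp_measurable hS _ (addr_ge0 t_ge0 hge0))).
      + exact: (mjp_measurable hS _ (addr_ge0 t_ge0 hge0)).
      + by move=> w [s _ []].
    - exact: finite_seq.
    - by move=> s r _ _ [w [[/= <- _] [/= <- _]]].
    - move=> s _; exact: (measurableI _ _ (state_measurable _)
                 (mjp_measurable hS _ (addr_ge0 t_ge0 hge0))).
  rewrite big_cons sumEFin -EFinD lee_fin => H.
  rewrite sumEFin -EFinM lee_fin.
  under eq_bigr do rewrite mulrA.
  by rewrite -mulr_suml mulrA ler_pM2r ?invr_gt0//; lra.
have lim1 : (\sum_(s <- F) (point_mass s * (p h s s' / h))%:E)%E @[h --> 0^'+]
    --> (\sum_(s <- F) (point_mass s * rate s s')%:E)%E.
  rewrite big_seq; under eq_fun do rewrite big_seq.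
  apply: cvg_nnesum => s sF.
    near=> h; rewrite lee_fin mulr_ge0 ?point_mass_ge0// divr_ge0//.
    by have [p0 _ _ _] := ptf; exact: p0.
  apply: cvg_EFin; first exact: nearW.
  apply: cvgMl_tmp; apply: prate.
  by apply/negP => /eqP e; move: (Fs' s sF); apply.
have lim2 : ((point_mass s')%:E * ((1 - p h s' s') / h)%:E)%E @[h --> 0^'+]
    --> ((point_mass s')%:E * \esum_(s in [set~ s']) (rate s' s)%:E)%E.
  exact: cvgeZl.
apply: (lee_cvg_to lim1 lim2); near=> h; apply: finite_time.
by near: h; exact: nbhs_right_gt.
Unshelve. all: by end_near. Qed.

End stationary_law.

(** * Weighted finite sets of naturals *)

Section weighted_subsets.
Context {R : realType} (q : R).
Hypotheses (q_gt0 : 0 < q) (q_lt1 : q < 1).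

Definition subset_weight (A : {fset nat}) : R := \prod_(k <- A) q ^+ k.

(** The elementary symmetric function of degree [d] in the powers of [q], written [e d] in the
    overview; [subset_sum_in d k] is [b d k] there. *)
Definition subset_sum (d : nat) : \bar R :=
  \esum_(A in [set A : {fset nat} | #|` A| = d]) (subset_weight A)%:E.

Definition subset_sum_in (d k : nat) : \bar R :=
  \esum_(A in [set A : {fset nat} | #|` A| = d /\ k \in A])
    (subset_weight A)%:E.

Lemma subset_weight_ge0 A : 0 <= subset_weight A.
Proof. by apply: prodr_ge0 => k _; rewrite exprn_ge0// ltW. Qed.

Lemma subset_sum_ge0 d : (0 <= subset_sum d)%E.
Proof. by apply: esum_ge0 => A _; rewrite lee_fin subset_weight_ge0. Qed.

Lemma subset_sum_in_ge0 d k : (0 <= subset_sum_in d k)%E.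
Proof. by apply: esum_ge0 => A _; rewrite lee_fin subset_weight_ge0. Qed.

Definition subset_sum_out (d k : nat) : \bar R :=
  \esum_(A in [set A : {fset nat} | #|` A| = d /\ k \notin A])
    (subset_weight A)%:E.

Lemma subset_sum_split d k :
  subset_sum d = (subset_sum_in d k + subset_sum_out d k)%E.
Proof.
rewrite /subset_sum (esumID [set A : {fset nat} | k \in A]).
  congr (_ + _)%E; congr esum; apply/seteqP.
  by split=> A [? ?]; split => //; apply/negP.
by move=> *; rewrite lee_fin subset_weight_ge0.
Qed.

(** Taking [k] out of a set that contains it lowers the cardinal by one and divides the weight by
    [q ^+ k]. *)
Lemma subset_sum_inS d k :
  subset_sum_in d.+1 k = ((q ^+ k)%:E * subset_sum_out d k)%E.
Proof.
rewrite -esumZl ?exprn_ge0 1?ltW//; last first.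
  by move=> *; rewrite lee_fin subset_weight_ge0.
rewrite /subset_sum_in (reindex_esum
  [set A : {fset nat} | #|` A| = d /\ k \notin A] _ (fun A => k |` A)%fset).
  apply: eq_esum => A [_ kA]; rewrite -EFinM; congr _%:E.
  by rewrite /subset_weight big_fsetU1.
split => [A [dA kA]|A B|A [dA kA]] /=.
- by rewrite cardfsU1 kA dA fset1U1.
- rewrite !inE /= => -[_ kA] [_ kB] /(congr1 (fun C => C `\ k)%fset).
  by rewrite !fsetU1K.
- exists (A `\ k)%fset; last by rewrite fsetD1K.
  split; last by rewrite !inE eqxx.
  by apply/eqP; rewrite -eqSS -dA (cardfsD1 k A) kA.
Qed.

(** Among the sets of size [d], those without [k], enlarged by [k], give the first term; those with
    [k] give the second. *)
Lemma subset_sum_in_rec d k :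
  (subset_sum_in d.+1 k + (q ^+ k)%:E * subset_sum_in d k =
   (q ^+ k)%:E * subset_sum d)%E.
Proof.
rewrite subset_sum_inS (subset_sum_split d k) ge0_muleDr 1?addeC//.
  exact: subset_sum_in_ge0.
by apply: esum_ge0 => A _; rewrite lee_fin subset_weight_ge0.
Qed.

(** Lowering every element by one is a bijection from the sets without 0 onto all sets of the same
    size, and each of the [d] elements accounts for one factor [q]. *)
Lemma subset_sum_out0 d : subset_sum_out d 0 = ((q ^+ d)%:E * subset_sum d)%E.
Proof.
rewrite -esumZl ?exprn_ge0 1?ltW//; last first.
  by move=> *; rewrite lee_fin subset_weight_ge0.
rewrite /subset_sum_out (reindex_esum
  [set A : {fset nat} | #|` A| = d] _ (fun A => [fset k.+1 | k in A])%fset).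
  apply: eq_esum => A /= dA; rewrite -EFinM; congr _%:E.
  rewrite /subset_weight big_imfset/=; last by move=> ? ? _ _ [].
  rewrite (eq_bigr (fun i => q * q ^+ i)); last by move=> i _; rewrite exprS.
  rewrite big_split/= big_const_seq count_predT iter_mulr_1; congr (_ ^+ _ * _).
  by rewrite -dA.
split => [A /= dA|A B|A [dA kA]] /=.
- split; last by apply/imfsetP => -[].
  by rewrite -dA card_imfset// => ? ? [].
- move=> _ _ AB; apply/fsetP => k.
  have : (k.+1 \in [fset k.+1 | k in A]%fset) =
      (k.+1 \in [fset k.+1 | k in B]%fset).
    by rewrite AB.
  by rewrite !(mem_imfset _ _ (succn_inj)).
- exists [fset k.-1 | k in A]%fset => /=.
    rewrite card_in_imfset//= => -[|i] [|j] //=; rewrite ?(negPf kA)//.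
    by move=> _ _ ->.
  apply/fsetP => k; apply/imfsetP/idP => /= [[j /imfsetP[i /= iA ->] ->]|].
    by case: i iA => //=; rewrite (negPf kA).
  case: k => [|k]; first by rewrite (negPf kA).
  by move=> kA'; exists k => //; apply/imfsetP; exists k.+1.
Qed.

Lemma subset_sum0 : subset_sum 0 = 1%E.
Proof.
rewrite /subset_sum (_ : [set A | _] = [set fset0]).
  rewrite esum_set1 ?lee_fin ?subset_weight_ge0//.
  by rewrite /subset_weight big_seq_fset0.
by apply/seteqP; split => A /=; [move/cardfs0_eq|move=> ->].
Qed.

Lemma subset_sum_in0 k : subset_sum_in 0 k = 0%E.
Proof.
rewrite /subset_sum_in (_ : [set A | _] = set0) ?esum_set0//.
by apply/seteqP; split => A //= [/cardfs0_eq ->].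
Qed.

Lemma geometric_esum_le :
  (\esum_(k in [set: nat]) (q ^+ k)%:E <= (1 - q)^-1%:E)%E.
Proof.
have qk0 k : (0 <= (q ^+ k)%:E)%E by rewrite lee_fin exprn_ge0// ltW.
rewrite -nneseries_esumT//; apply: lime_le; first exact: is_cvg_nneseries.
apply: nearW => n; rewrite sumEFin lee_fin.
have := @geometric_le_lim R n 1 q ler01 q_gt0.
rewrite gtr0_norm// => /(_ q_lt1); rewrite mul1r => le_lim.
apply: le_trans le_lim.
by rewrite /series /=; apply: ler_sum => k _; rewrite /geometric /= mul1r.
Qed.

(** A set of size [d.+1] is counted at least once in the sum over [k] of [subset_sum_in d.+1 k];
    each of these is at most [q ^+ k] times [subset_sum d], and the geometric series converges. *)
Lemma subset_sum_fin d : (subset_sum d < +oo)%E.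
Proof.
elim: d => [|d IH]; first by rewrite subset_sum0 ltry.
apply: (@le_lt_trans _ _ (\esum_(k in [set: nat]) subset_sum_in d.+1 k)%E).
  rewrite /subset_sum_in; under eq_esum => k _ do rewrite esum_mkcond.
  rewrite esum_exchange; last first.
    by move=> k A; case: ifP => // _; rewrite lee_fin subset_weight_ge0.
  rewrite /subset_sum esum_mkcond; apply: le_esum => A _.
  case: ifPn; last first.
    move=> _; apply: esum_ge0 => k _.
    by case: ifP => // _; rewrite lee_fin subset_weight_ge0.
  rewrite inE /= => dA.
  have [k kA] : exists k, k \in A.
    by apply/fset0Pn; rewrite -cardfs_gt0 dA.
  apply: (le_trans _ (esum_ge_term _ (i:=k) _)) => //.
  by rewrite ifT// inE.
apply: (@le_lt_trans _ _ (\esum_(k in setT) (subset_sum d * (q ^+ k)%:E))%E).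
  apply: le_esum => k _; rewrite muleC -subset_sum_in_rec leeDl//.
  by rewrite mule_ge0 ?subset_sum_in_ge0// lee_fin exprn_ge0// ltW.
have F : subset_sum d \is a fin_num by rewrite ge0_fin_numE ?subset_sum_ge0.
rewrite -(fineK F) esumZl ?fine_ge0 ?subset_sum_ge0//.
  apply: (@le_lt_trans _ _ ((fine (subset_sum d))%:E * (1 - q)^-1%:E)%E).
    rewrite lee_wpmul2l ?geometric_esum_le// lee_fin.
    by rewrite fine_ge0 ?subset_sum_ge0.
  by rewrite -EFinM ltry.
by move=> k; rewrite lee_fin exprn_ge0// ltW.
Qed.

Lemma subset_sum_fin_num d : subset_sum d \is a fin_num.
Proof. by rewrite ge0_fin_numE ?subset_sum_ge0 ?subset_sum_fin. Qed.

Lemma subset_sum_in_fin_num d k : subset_sum_in d k \is a fin_num.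
Proof.
rewrite ge0_fin_numE ?subset_sum_in_ge0//.
apply: le_lt_trans (subset_sum_fin d); rewrite (subset_sum_split d k) leeDl//.
by apply: esum_ge0 => A _; rewrite lee_fin subset_weight_ge0.
Qed.

(** The split at [k = 0]: the sets that contain 0 contribute [q ^+ d * subset_sum d], the others
    [q ^+ d.+1 * subset_sum d.+1]. *)
Lemma subset_sum_rec d :
  (1 - q ^+ d.+1) * fine (subset_sum d.+1) = q ^+ d * fine (subset_sum d).
Proof.
have := subset_sum_split d.+1 0.
rewrite subset_sum_inS !subset_sum_out0 expr0 mul1e.
rewrite -(fineK (subset_sum_fin_num d)) -(fineK (subset_sum_fin_num d.+1)).
by rewrite -!EFinM -EFinD => -[] /=; lra.
Qed.

Lemma subset_sum_gt0 d : 0 < fine (subset_sum d).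
Proof.
elim: d => [|d IH]; first by rewrite subset_sum0.
have : 0 < (1 - q ^+ d.+1) * fine (subset_sum d.+1).
  by rewrite subset_sum_rec mulr_gt0// exprn_gt0.
by rewrite pmulr_rgt0// subr_gt0 exprn_ilt1// ltW.
Qed.

End weighted_subsets.

(** * Label vectors *)

Section labels.
Variable d : nat.
Implicit Types x y : Zplus d.

Lemma crd_lt x (i j : 'I_d) : (i < j)%N -> (crd x i < crd x j)%N.
Proof. by case: x => f /= hf; move: (set_mem hf); exact. Qed.

Lemma crd_inj x : injective (crd x).
Proof.
move=> i j e; apply/val_inj; case: (ltngtP i j) => // /(crd_lt x); 
  by rewrite e ltnn.
Qed.

Lemma crd_ext x y : crd x =1 crd y -> x = y.
Proof. by move=> h; apply/val_inj/ffunP. Qed.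

Lemma crd_mk (f : 'I_d -> nat) :
  (forall i j : 'I_d, (i < j)%N -> (f i < f j)%N) -> exists x, crd x =1 f.
Proof.
move=> hf; have fZ : [ffun i => f i] \in Zplus d.
  by rewrite inE => i j ij; rewrite !ffunE hf.
by exists (SigSub fZ) => i; rewrite /crd /= ffunE.
Qed.

Lemma leq_crd x (i : 'I_d) : (i <= crd x i)%N.
Proof.
case: i => i; elim: i => [//|i IH] hi.
by apply: leq_ltn_trans (IH (ltnW hi)) (crd_lt x _).
Qed.

Definition label_set x : {fset nat} := [fset crd x j | j in 'I_d]%fset.

Lemma in_label_set x k : (k \in label_set x) = [exists j, crd x j == k].
Proof.
apply/imfsetP/existsP => [[j _ ->]|[j /eqP <-]]; first by exists j.
by exists j.
Qed.

Lemma card_label_set x : #|` label_set x| = d.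
Proof.
by rewrite card_imfset /=; [rewrite -cardE card_ord|exact: crd_inj].
Qed.

(** An increasing vector is the sorted list of its values, which gives injectivity; sorting a set of
    size [d] gives surjectivity. *)
Lemma label_set_bij :
  set_bij [set: Zplus d] [set A : {fset nat} | #|` A| = d] label_set.
Proof.
split => [x _|x y _ _ xy|A /= dA].
- exact: card_label_set.
- have sorted_label z : sort leq (label_set z) = [seq crd z j | j <- enum 'I_d].
    apply: (sorted_eq leq_trans anti_leq).
    + by apply: sort_sorted; exact: leq_total.
    + rewrite sorted_map; apply: sub_sorted (_ : sorted (relpre val ltn) _).
        by move=> i j /= /(crd_lt z)/ltnW.
      by rewrite -sorted_map val_enum_ord iota_ltn_sorted.
    + rewrite perm_sort; apply: uniq_perm; first exact: fset_uniq.
        by rewrite map_inj_uniq ?enum_uniq//; exact: crd_inj.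
      move=> k; rewrite in_label_set; apply/existsP/mapP => -[j].
        by move/eqP => <-; exists j; rewrite ?mem_enum.
      by move=> _ ->; exists j.
  apply: crd_ext => i.
  have := sorted_label x; rewrite xy sorted_label => /eq_in_map -> //.
  by rewrite mem_enum.
- have ltA : sorted ltn (sort leq A).
    by rewrite ltn_sorted_uniq_leq sort_uniq fset_uniq sort_sorted//;
      exact: leq_total.
  have sA : size (sort leq A) = d by rewrite size_sort.
  have [i j ij|x xE] := @crd_mk (fun i => nth 0%N (sort leq A) i).
    apply: (sorted_ltn_nth ltn_trans) => //.
    + by rewrite inE sA.
    + by rewrite inE sA.
  exists x => //; apply/fsetP => k; rewrite in_label_set.
  apply/existsP/idP => [[j /eqP <-]|kA].
    by rewrite xE -(mem_sort leq) mem_nth// sA.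
  move: kA; rewrite -(mem_sort leq) => kA.
  have kd : (index k (sort leq A) < d)%N by rewrite -sA index_mem.
  by exists (Ordinal kd); rewrite xE /= nth_index.
Qed.

(** The move of one label up to a free value, regardless of where the particles stand in a
    configuration. *)
Definition raise x y (j : 'I_d) : Prop :=
  (forall i, crd x i != (crd x j).+1) /\
  (forall i, crd y i = if i == j then (crd x j).+1 else crd x i).

(** Lowering one coordinate at a time leads from any vector to the least one, whose coordinates are
    their own indices; the induction is on a bound [n] of the sum of the coordinates. *)
Lemma raise_connected (X : Type) (phi : Zplus d -> X) :
  (forall x y j, raise x y j -> phi x = phi y) -> forall x y, phi x = phi y.
Proof.
move=> phiE; have [x0 x0E] := @crd_mk (fun i => i) (fun _ _ => id).
suff h n : forall x, (\sum_j crd x j <= n)%N -> phi x = phi x0.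
  by move=> x y; rewrite (h _ x (leqnn _)) (h _ y (leqnn _)).
elim: n => [|n IH] x sx.
  congr phi; apply: crd_ext => i; rewrite x0E.
  have : (crd x i <= 0)%N by apply: leq_trans sx; rewrite (bigD1 i)//= leq_addr.
  by rewrite leqn0 => /eqP; have := leq_crd x i; lia.
have [/forallP hx|] := boolP [forall i : 'I_d, crd x i == i :> nat].
  by congr phi; apply: crd_ext => i; rewrite x0E; exact/eqP.
rewrite negb_forall => /existsP hj.
(* The first coordinate that exceeds its index can be lowered: the earlier ones equal their indices,
   so they stay below it. *)
have {hj}[j /andP[xj /forallP jmin]] : exists j : 'I_d, (crd x j != j :> nat) &&
    [forall i : 'I_d, (i < j)%N ==> (crd x i == i :> nat)].
  case: hj => j0 hj0.
  case: (@arg_minnP _ j0 (fun j => crd x j != j :> nat) val hj0) => j hj jm.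
  exists j; rewrite hj; apply/forallP => i; apply/implyP => ij.
  by apply: contraTT ij => /jm; rewrite -leqNgt.
have jx : (j < crd x j)%N by rewrite ltn_neqAle eq_sym xj leq_crd.
have [i k ik|y yE] :=
    @crd_mk (fun i => if i == j then (crd x j).-1 else crd x i).
  case: (eqVneq i j) => [ij|ij]; case: (eqVneq k j) => [kj|kj].
  - by move: ik; rewrite ij kj ltnn.
  - by have := crd_lt x ik; rewrite ij; lia.
  - have := jmin i; rewrite -kj ik /= => /eqP ->; move: jx; rewrite -kj; lia.
  - exact: crd_lt.
rewrite -(phiE y x j).
- apply: IH; rewrite -ltnS; apply: leq_trans sx.
  rewrite (bigD1 j)//= [leqRHS](bigD1 j)//= yE eqxx.
  rewrite (eq_bigr (fun i => crd x i)); first by lia.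
  by move=> i ij; rewrite yE (negPf ij).
- have yj : (crd y j).+1 = crd x j 
    by rewrite yE eqxx prednK//; apply: leq_trans jx.
  split => i; rewrite yj; last first.
    by case: eqP => [->//|/eqP ij]; rewrite yE (negPf ij).
  rewrite yE; case: (eqVneq i j) => [_|ij].
    by rewrite neq_ltn ltn_predL (leq_trans _ jx).
  by apply: contra ij => /eqP/crd_inj ->.
Qed.

Context {R : realType} (q : R).

Definition label_weight x : R := \prod_j q ^+ crd x j.

Lemma label_weightE x : label_weight x = subset_weight q (label_set x).
Proof.
rewrite /subset_weight big_imfset /=; last by move=> ? ? _ _; exact: crd_inj.
by rewrite big_enum.
Qed.

Lemma label_weight_raise x y j : raise x y j ->
  label_weight y = q * label_weight x.
Proof.
move=> [_ yE]; rewrite /label_weight (bigD1 j)//= [in RHS](bigD1 j)//= yE eqxx.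
rewrite exprS mulrA; congr (_ * _); apply: eq_bigr => i ij.
by rewrite yE (negPf ij).
Qed.

Lemma esum_label_weight :
  \esum_(x in setT) (label_weight x)%:E = subset_sum q d.
Proof.
rewrite /subset_sum (reindex_esum _ _ _ _ label_set_bij).
by apply: eq_esum => x _; rewrite label_weightE.
Qed.

Lemma esum_label_weight_in k :
  \esum_(x in [set x | k \in label_set x]) (label_weight x)%:E =
  subset_sum_in q d k.
Proof.
rewrite /subset_sum_in (reindex_esum [set x | k \in label_set x] _ label_set).
  by apply: eq_esum => x _; rewrite label_weightE.
have [h1 h2 h3] := label_set_bij; split.
- by move=> x kx; split => //; exact: h1.
- by move=> x y _ _; apply: h2; rewrite inE.
- by move=> A [/h3 [x _ <-] kA]; exists x.
Qed.

End labels.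

(** * Particle configurations *)

Lemma finite_int_bounded (A : set int) : finite_set A ->
  exists n : nat, forall i, A i -> (`|i| <= n)%N.
Proof.
move=> Af; exists (\max_(i <- fset_set A) `|i|%N) => i Ai.
by apply: leq_bigmax_seq => //; rewrite in_fset_set// inE.
Qed.

Section configurations.
Implicit Types z : Omega.

Lemma occ_ext z z' : occ z =1 occ z' -> z = z'.
Proof. by move=> h; apply/val_inj/funext. Qed.

Lemma occ_mk (f : int -> bool) : Omega f -> exists z, occ z =1 f.
Proof. by move=> hf; exists (SigSub (mem_set hf)). Qed.

Lemma omegaP z : finite_set [set i : int | i <= 0 /\ occ z i] /\
  finite_set [set i : int | 1 <= i /\ ~~ occ z i].
Proof. by case: z => f hf; exact: (set_mem hf). Qed.

Lemma omega_bounded z : exists n : nat,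
  (forall i : int, i < - n%:Z -> ~~ occ z i) /\
  (forall i : int, n%:Z < i -> occ z i).
Proof.
have [/finite_int_bounded[a ha] /finite_int_bounded[b hb]] := omegaP z.
exists (a + b)%N; split => i hi; last first.
  apply: contraLR isT => /negP oi; have := hb i; rewrite /= => H.
  have : (`|i| <= b)%N by apply: H; split; [lia|apply/negP].
  lia.
apply/negP => oi; have := ha i; rewrite /= => H.
have : (`|i| <= a)%N by apply: H; split; [lia|].
lia.
Qed.

Lemma finite_left z i : finite_set [set k : int | k < i /\ occ z k].
Proof.
have [n [hn _]] := omega_bounded z.
apply: (@sub_finite_set _ _ ((fun k : nat => i - k%:Z) @` `I_(`|i| + n).+2)).
  move=> k /= [ki ok]; exists `|(i - k)%R|%N; last by lia.
  by case: (ltP k (- n%:Z)) => [/hn|]; [rewrite ok|lia].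
exact/finite_image/finite_II.
Qed.

Lemma labelS z i : label z (i + 1) = (label z i + occ z i)%N.
Proof.
rewrite /label; have [oi|oi] := boolP (occ z i).
  rewrite (_ : [set k | _ < i + 1 /\ _] =
    i |` [set k : int | k < i /\ occ z k]).
    rewrite fset_setU1 ?cardfsU1//; last exact: finite_left.
    rewrite in_fset_set; last exact: finite_left.
    by rewrite addnC memNset//= ltxx; case.
  apply/seteqP; split => [k /= [ki ok]|k /= [->|[ki ok]]].
  - by have [->|ki'] := eqVneq k i; [left|right; split => //; lia].
  - by split => //; lia.
  - by split => //; lia.
rewrite addn0; congr #|` fset_set _ |; apply/seteqP; split => k /= [ki ok].
  by split => //; have [e|ki'] := eqVneq k i; [by rewrite -e ok in oi|lia].
by split => //; lia.
Qed.

Lemma label_le z i j : i <= j -> (label z i <= label z j)%N.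
Proof.
move=> ij; have -> : j = i + `|(j - i)%R|%N%:Z by lia.
elim: `|(j - i)%R|%N => [|n IH]; first by rewrite addr0.
rewrite (_ : i + n.+1%:Z = i + n%:Z + 1); last by lia.
by rewrite labelS (leq_trans IH)// leq_addr.
Qed.

Lemma label_eq0 z i : (forall k, k < i -> ~~ occ z k) -> label z i = 0%N.
Proof.
move=> h; rewrite /label (_ : [set k | _] = set0) ?fset_set0 ?cardfs0//.
by apply/seteqP; split => k //= [/h /negP].
Qed.

Lemma label_unbounded z l : exists i, (l < label z i)%N.
Proof.
have [n [_ hn]] := omega_bounded z.
exists (n%:Z + 1 + l.+1%:Z); elim: l => [|l IH].
  by rewrite labelS hn ?addn1//; lia.
rewrite (_ : n%:Z + 1 + l.+2%:Z = n%:Z + 1 + l.+1%:Z + 1); last by lia.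
by rewrite labelS hn ?addn1//; lia.
Qed.

(** A discrete intermediate value argument: the label is 0 far to the left, unbounded to the right,
    and grows by at most 1 per site. *)
Lemma label_surj z l : exists i, occ z i /\ label z i = l.
Proof.
have [n [hn _]] := omega_bounded z; have [i0 hi0] := label_unbounded z l.
have low : label z (- n%:Z) = 0%N by apply: label_eq0.
have ex : exists k, (l < label z (- n%:Z + k%:Z)%R)%N.
  exists `|(i0 + n%:Z)%R|%N; case: (leP (- n%:Z) i0) => hi.
    by have -> : - n%:Z + `|(i0 + n%:Z)%R|%N%:Z = i0 by lia.
  by move: hi0; have := label_le z (ltW hi); rewrite low leqn0 => /eqP ->.
(* Just before the first site whose label exceeds [l], the label is [l] and the site is occupied. *)
case: (ex_minnP ex) => -[|k]; first by rewrite addr0 low.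
rewrite (_ : - n%:Z + k.+1%:Z = - n%:Z + k%:Z + 1); last by lia.
rewrite labelS => lk kmin; exists (- n%:Z + k%:Z).
have := kmin k; move: lk; case: (occ z _); lia.
Qed.

Lemma label_inj z i j : occ z i -> occ z j -> label z i = label z j -> i = j.
Proof.
wlog ij : i j / i <= j => [H oi oj e|oi oj e].
  by case: (leP i j) => [|/ltW] h; [exact: H|symmetry; exact: H].
apply/eqP; rewrite eq_le ij leNgt; apply/negP => ji.
have : (label z (i + 1)%R <= label z j)%N by apply: label_le; lia.
by rewrite labelS oi; lia.
Qed.

Lemma siteP z l : occ z (site z l) /\ label z (site z l) = l.
Proof.
have [i il] := label_surj z l.
exact: (@xgetPex _ 0 [set i | occ z i /\ label z i = l] (ex_intro _ i il)).
Qed.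

Lemma site_uniq z i l : occ z i -> label z i = l -> site z l = i.
Proof.
move=> oi li; have [os sl] := siteP z l.
by apply: (@label_inj z) => //; rewrite sl.
Qed.

Lemma particle_jump_ex z i j : occ z i -> ~~ occ z j ->
  exists z', particle_jump z z' i j.
Proof.
move=> oi oj.
pose f k := if k == i then false else if k == j then true else occ z k.
have [z' z'E] : exists z', occ z' =1 f.
  apply: occ_mk; have [fl fr] := omegaP z; split.
    apply: (@sub_finite_set _ _ ([set k | k <= 0 /\ occ z k] `|` [set j])).
      move=> k /= [k0]; rewrite /f; case: eqP => // _; case: eqP => [->|_ ok].
        by right.
      by left.
    by rewrite finite_setU; split => //; exact: finite_set1.
  apply: (@sub_finite_set _ _ ([set k | 1 <= k /\ ~~ occ z k] `|` [set i])).
    move=> k /= [k0]; rewrite /f; case: eqP => [->|_]; first by right.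
    by case: eqP => // _ ok; left.
  by rewrite finite_setU; split => //; exact: finite_set1.
by exists z'; split.
Qed.

Lemma particle_jump_uniq z z1 z2 i j :
  particle_jump z z1 i j -> particle_jump z z2 i j -> z1 = z2.
Proof. by move=> [_ _ h1] [_ _ h2]; apply: occ_ext => k; rewrite h1 h2. Qed.

Lemma particle_jump_rev z z' i j :
  particle_jump z z' i j -> particle_jump z' z j i.
Proof.
move=> [oi oj h]; have ij : i != j by apply: contraTneq oi => ->.
split => [||k]; first by rewrite h eqxx eq_sym (negPf ij).
- by rewrite h eqxx.
- rewrite h; case: (eqVneq k j) => [->|kj]; first by rewrite (negPf oj).
  by case: (eqVneq k i) => [->|ki] /=; rewrite ?oi.
Qed.

(** * Effect of a jump to the right on the labels *)

Section jump_right.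
Variables (z z' : Omega) (i : int).
Hypothesis zz' : particle_jump z z' i (i + 1).

Let occ_i : occ z i. Proof. by case: zz'. Qed.
Let occ_i1 : ~~ occ z (i + 1). Proof. by case: zz'. Qed.
Let occE k : occ z' k = if k == i then false else if k == i + 1 then true
                        else occ z k.
Proof. by case: zz' => _ _. Qed.

Lemma label_jump_left k : k <= i -> label z' k = label z k.
Proof.
move=> ki; congr #|` fset_set _ |; apply/seteqP; split => j /= [jk].
  by rewrite occE; case: eqP; [lia|case: eqP; [lia|]].
by rewrite occE; case: eqP; [lia|case: eqP; [lia|]].
Qed.

Lemma label_jump_target : label z' (i + 1) = label z i.
Proof. by rewrite labelS label_jump_left// occE eqxx addn0. Qed.

(** From [i + 2] on, the moving particle is counted to the left both before and after the jump. *)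
Lemma label_jump_right k : i + 2 <= k -> label z' k = label z k.
Proof.
move=> ki; have -> : k = i + 1 + 1 + `|(k - (i + 2))%R|%N%:Z by lia.
elim: `|_|%N => [|n IH].
  rewrite addr0 !labelS label_jump_left// occ_i (negPf occ_i1) occE eqxx.
  by rewrite occE eqxx ifF//; apply/eqP; lia.
rewrite (_ : i + 1 + 1 + n.+1%:Z = i + 1 + 1 + n%:Z + 1); last by lia.
by rewrite !(labelS _ (_ + n%:Z)) IH occE !ifF//; apply/eqP; lia.
Qed.

End jump_right.

Lemma site_lt z l : site z l < site z l.+1.
Proof.
have [occ1 l1] := siteP z l; have [occ2 l2] := siteP z l.+1.
by rewrite ltNge; apply/negP => /(label_le z); rewrite l1 l2 ltnn.
Qed.

Lemma site_gap z l i : site z l < i -> i < site z l.+1 -> ~~ occ z i.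
Proof.
move=> h1 h2; apply/negP => oi.
have [occ1 l1] := siteP z l; have [occ2 l2] := siteP z l.+1.
have : (label z (site z l + 1)%R <= label z i)%N by apply: label_le; lia.
have : (label z (i + 1)%R <= label z (site z l.+1))%N by apply: label_le; lia.
by rewrite !labelS occ1 oi l1 l2; lia.
Qed.

(* A particle followed by an empty site can jump towards the next one, so that
   the distance between consecutive particles can be brought down to 1. *)
Lemma close_gap z l : site z l + 1 < site z l.+1 ->
  exists z', [/\ particle_jump z z' (site z l) (site z l + 1),
    site z' l = site z l + 1 & site z' l.+1 = site z l.+1].
Proof.
move=> gap; have [occ1 l1] := siteP z l; have [occ2 l2] := siteP z l.+1.
have oi1 : ~~ occ z (site z l + 1) by apply: (@site_gap z l) => //; lia.
have [z' zz'] := particle_jump_ex occ1 oi1; exists z'; have [_ _ zE] := zz'.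
split => //; apply: site_uniq.
- by rewrite zE eqxx ifF//; apply/eqP; lia.
- by rewrite (label_jump_target zz').
- by rewrite zE !ifF//; apply/eqP; lia.
- by rewrite (label_jump_right zz')//; lia.
Qed.

End configurations.

(** Countability of the state space: a configuration is determined by its finitely many particles at
    sites [i <= 0] and its finitely many holes at sites [1 <= i]. *)
Lemma coupled_state_inj (d : nat) :
  exists f : coupled_state d -> nat, injective f.
Proof.
exists (fun s : coupled_state d =>
  choice.pickle ((enum_fset (fset_set [set i : int | i <= 0 /\ occ s.1 i]),
    enum_fset (fset_set [set i : int | 1 <= i /\ ~~ occ s.1 i]), val s.2)
    : seq int * seq int * {ffun 'I_d -> nat})).
move=> [z x] [z' x'] /(pcan_inj choice.pickleK) /= [].
move=> /val_inj eL /val_inj eR /val_inj ->.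
congr pair; apply: occ_ext => i.
have [zL zR] := omegaP z; have [zL' zR'] := omegaP z'.
have mem_eq (A B : set int) : finite_set A -> finite_set B ->
    fset_set A = fset_set B -> A i <-> B i.
  move=> Af Bf AB; have : (i \in fset_set A) = (i \in fset_set B) by rewrite AB.
  by rewrite !in_fset_set// => h; split => ?; apply: set_mem;
    [rewrite -h|rewrite h]; exact: mem_set.
case: (leP i 0) => i0.
  have /= [h1 h2] := mem_eq _ _ zL zL' eL.
  by apply/idP/idP => o; [case: h1|case: h2].
have /= [h1 h2] := mem_eq _ _ zR zR' eR.
by apply/idP/idP; apply: contraTT => o; [case: h2 => //|case: h1 => //]; split.
Qed.

(** * The blocking measure *)

Section discrete_law.
Context {R : realType} {E : choiceType}.
Context {disp : measure_display} {T : measurableType disp}.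
Variables (P : probability T R) (X : T -> E).
Hypothesis mX : forall A : set E, measurable (X @^-1` A).

(** The injection numbers the states, so that countable additivity applies to the events [F n], each
    of which comes from at most one state. *)
Lemma prob_esum (f : E -> nat) (A : set E) : injective f ->
  P (X @^-1` A) = \esum_(s in A) P (X @^-1` [set s]).
Proof.
move=> f_inj; pose F n := X @^-1` (A `&` f @^-1` [set n]).
rewrite (_ : X @^-1` A = \bigcup_n F n); last first.
  by apply/seteqP; split => [w Aw|w [n _ []//]]; exists (f (X w)).
have -> : P (\bigcup_n F n) = (\sum_(n <oo) P (F n))%E.
  apply: measure_semi_bigcup => [n||]; first exact: mX.
    by move=> n k _ _ [w [[_ /= <-] [_ /= <-]]].
  by apply: bigcup_measurable => n _; exact: mX.
rewrite nneseries_esumT//.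
transitivity (\esum_(n in f @` A) P (F n)).
  rewrite [RHS]esum_mkcond; apply: eq_esum => n _; case: ifPn => //.
  rewrite notin_setE => nA; rewrite (_ : F n = set0) ?measure0//.
  by apply/seteqP; split => // w [Aw fw]; apply: nA; exists (X w).
rewrite esum_image; last by move=> ? ? _ _; exact: f_inj.
apply: eq_esum => s As; congr (P _); apply/seteqP; split => w /=.
  by move=> [_ /f_inj].
by move=> Xw; rewrite /F /preimage /= Xw.
Qed.

End discrete_law.

Lemma omega_inj : exists f : Omega -> nat, injective f.
Proof.
have [f f_inj] := coupled_state_inj 0.
have [|x _] := @crd_mk 0 (fun=> 0%N); first by case.
by exists (fun z => f (z, x)) => z z' /f_inj [].
Qed.

Section blocking_measure.
Context {R : realType} (q c : R).
Hypothesis q_gt0 : 0 < q.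
Context {disp : measure_display} {T : measurableType disp}.
Variables (P : probability T R) (xi : T -> Omega).
Hypothesis mxi : forall A : set Omega, measurable (xi @^-1` A).
Hypothesis xi_law : blocking_law q c P xi.

Definition config_mass (z : Omega) : R := fine (P (xi @^-1` [set z])).

(** The odds of a particle at [i] under [mu^c]; they are divided by [q] when [i] grows by 1. *)
Definition fugacity (i : int) : R := q `^ (c - i%:~R).

Definition density (i : int) : R := fugacity i / (1 + fugacity i).

Lemma fugacity_gt0 i : 0 < fugacity i.
Proof. exact: powR_gt0. Qed.

Lemma fugacityS i : fugacity i = q * fugacity (i + 1).
Proof.
rewrite /fugacity intrD mulr1z opprD addrA.
rewrite -[X in X * _](powRr1 (ltW q_gt0)) -powRD.
  by congr (_ `^ _); ring.
by apply/implyP => _; rewrite gt_eqF.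
Qed.

Lemma fugacity_sub (k : nat) i : fugacity (i - k%:Z) = q ^+ k * fugacity i.
Proof.
elim: k => [|k IH]; first by rewrite subr0 mul1r.
rewrite fugacityS (_ : i - k.+1%:Z + 1 = i - k%:Z); last by lia.
by rewrite IH exprS mulrA.
Qed.

Lemma config_massE z : (config_mass z)%:E = P (xi @^-1` [set z]).
Proof. by rewrite fineK// fin_num_measure. Qed.

Lemma config_mass_ge0 z : 0 <= config_mass z.
Proof. by rewrite fine_ge0. Qed.

Lemma config_prob (A : set Omega) :
  P (xi @^-1` A) = \esum_(z in A) (config_mass z)%:E.
Proof.
have [f f_inj] := omega_inj; rewrite (prob_esum P mxi A f_inj).
by apply: eq_esum => z _; rewrite config_massE.
Qed.

Lemma prob_occ i : P [set w | occ (xi w) i] = (density i)%:E.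
Proof. exact: xi_law.2. Qed.

Lemma prob_empty i : P [set w | ~~ occ (xi w) i] = (1 - density i)%:E.
Proof.
rewrite EFinB -prob_occ -(probability_setC P (mxi [set z | occ z i])).
by congr (P _); apply/seteqP; split => w /= /negP.
Qed.

Lemma prob_occ_eq i (b : bool) : P [set w | occ (xi w) i = b] =
  (if b then density i else 1 - density i)%:E.
Proof.
case: b; first exact: prob_occ.
rewrite -prob_empty; congr (P _); apply/seteqP.
by split => w /=; [move=> ->|move/negPf].
Qed.

Definition window (N : nat) : {fset int} :=
  [fset k%:Z - N%:Z | k in iota 0 N.*2.+1]%fset.

Lemma in_window N i : (i \in window N) = (`|i| <= N)%N.
Proof.
apply/imfsetP/idP => /= [[k]|iN]; first by rewrite inE mem_iota => ? ->; lia.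
exists `|(i + N%:Z)%R|%N; last by lia.
by rewrite inE mem_iota; lia.
Qed.

Definition site_mass (z : Omega) (k : int) : R :=
  if occ z k then density k else 1 - density k.

(* The sites [i] and [j] are singled out so that configurations that differ
   only there can be compared factor by factor. *)
Lemma config_mass_limit z i j : i != j ->
  site_mass z i * (site_mass z j *
    \prod_(k <- (window N `\ i `\ j)%fset) site_mass z k) @[N --> \oo] -->
  config_mass z.
Proof.
move=> ij.
pose J N := (i |` (j |` (window N `\ i `\ j)))%fset.
have inJ N k : (`|k| <= N)%N -> k \in J N.
  move=> kN; rewrite !inE; have [//|ki] := eqVneq k i.
  by have [//|kj] := eqVneq k j; rewrite in_window kN.
(* Cylinder events decreasing to the event that [xi] is [z]; by independence their probabilities are
   finite products. *)
pose F N := xi @^-1` [set z' | forall k, k \in J N -> occ z' k = occ z k].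
have FE N : P (F N) = (site_mass z i * (site_mass z j *
    \prod_(k <- (window N `\ i `\ j)%fset) site_mass z k))%:E.
  rewrite (xi_law.1 (J N) (fun k => [set b | b = occ z k])).
  rewrite (eq_bigr (fun k => (site_mass z k)%:E)); last first.
    by move=> k _; exact: prob_occ_eq.
  rewrite prodEFin; congr _%:E; rewrite big_fsetU1 ?big_fsetU1//=.
    by rewrite !inE eqxx.
  by rewrite !inE eqxx/= andbF orbF.
have bigF : \bigcap_N F N = xi @^-1` [set z].
  apply/seteqP; split => [w Fw|w /= wz N _ k _]; last by rewrite wz.
  by apply: occ_ext => k; apply: (Fw `|k|%N) => //; exact: inJ.
have lim : (P \o F) N @[N --> \oo] --> (config_mass z)%:E.
  rewrite config_massE -bigF; apply: nonincreasing_cvg_mu.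
  - exact: le_lt_trans (probability_le1 _ (mxi _)) (ltry _).
  - by move=> N; exact: mxi.
  - by rewrite bigF; exact: mxi.
  - move=> N M NM; rewrite subsetEset => w Fw k kJ; apply: Fw.
    move: kJ; rewrite !inE !in_window.
    by move=> /orP[->//|/orP[->|/andP[-> /andP[-> /leq_trans ->]]]];
      rewrite ?orbT.
rewrite (_ : (fun N => _) = fine \o (P \o F)); first exact: fine_cvg.
by apply/funext => N /=; rewrite FE.
Qed.

(** Only the factors at [i] and [i + 1] differ between the finite products of the two
    configurations; their quotient is the ratio of the fugacities at [i] and [i + 1], that is [q],
    and it survives the limit. *)
Lemma config_mass_balance z z' i : particle_jump z z' i (i + 1) ->
  config_mass z = q * config_mass z'.
Proof.
move=> zz'; have [oi oi1 zE] := zz'.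
have ii1 : i != i + 1 by apply/eqP; lia.
have l1 := config_mass_limit (z:=z) ii1.
have l2 := config_mass_limit (z:=z') ii1.
apply: (cvg_unique _ l1) => //; rewrite (_ : (fun N => _) = (fun N => q *
    (site_mass z' i * (site_mass z' (i + 1) *
      \prod_(k <- (window N `\ i `\ (i + 1)%R)%fset) site_mass z' k)))).
  by apply: cvgMl_tmp; exact: l2.
apply/funext => N; rewrite (eq_big_seq (site_mass z')); last first.
  move=> k; rewrite !inE => /andP[ki1 /andP[ki _]].
  by rewrite /site_mass zE (negPf ki) (negPf ki1).
rewrite !mulrA; congr (_ * _); rewrite /site_mass oi (negPf oi1) !zE !eqxx.
rewrite eq_sym (negPf ii1) /density (fugacityS i).
have := fugacity_gt0 (i + 1); set y := fugacity _ => y0.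
have qy : 0 < q * y by exact: mulr_gt0.
by field; apply/andP; split; rewrite gt_eqF// ltr_wpDl.
Qed.

End blocking_measure.

Lemma eadd_eqE (R : realType) (x : \bar R) (a b : R) :
  (x + a%:E = b%:E)%E -> x = (b - a)%:E.
Proof. by case: x => [r [<-]| |] //; rewrite addrK. Qed.

Section blocking_measure_sums.
Context {R : realType} (q c : R).
Hypotheses (q_gt0 : 0 < q) (q_lt1 : q < 1).
Context {disp : measure_display} {T : measurableType disp}.
Variables (P : probability T R) (xi : T -> Omega).
Hypothesis mxi : forall A : set Omega, measurable (xi @^-1` A).
Hypothesis xi_law : blocking_law q c P xi.

Let fug := fugacity q c.
Let dens := density q c.
Let mass := config_mass P xi.

(** * Summability of the probabilities that a jump is possible *)

Lemma density_le i : density q c i <= fugacity q c i.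
Proof.
have := fugacity_gt0 c q_gt0 i => h.
by rewrite /density ler_pdivrMr ?addr_gt0// ler_peMr ?lerDl// ltW.
Qed.

Lemma density_ge i : 1 - density q c i <= (fugacity q c i)^-1.
Proof.
have := fugacity_gt0 c q_gt0 i => h.
have -> : 1 - density q c i = (1 + fugacity q c i)^-1.
  by rewrite /density; field; lra.
by rewrite lef_pV2 ?posrE ?addr_gt0// lerDr.
Qed.

(** Holds when a jump across the bond from [i] to [i + 1] is possible, in one direction or the
    other. *)
Definition active (z : Omega) (i : int) : bool := occ z i != occ z (i + 1).

(** An active bond has one occupied and one empty end. The first bound is small far to the left, the
    second far to the right. *)
Lemma prob_active_le i : (P [set w | active (xi w) i] <=
  (dens i + dens (i + 1))%:E /\
  P [set w | active (xi w) i] <=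
  ((1 - dens i) + (1 - dens (i + 1)))%:E)%E.
Proof.
have cover (A B C : set Omega) : A `<=` B `|` C ->
    (P (xi @^-1` A) <= P (xi @^-1` B) + P (xi @^-1` C))%E.
  move=> ABC; apply: le_trans (measureU2 P (mxi B) (mxi C)).
  by apply: le_measure; rewrite ?inE; [exact: mxi|exact: measurableU|
    move=> w /ABC].
split; rewrite EFinD.
  rewrite -!(prob_occ xi_law).
  apply: (cover [set z | active z i] [set z | occ z i]
    [set z | occ z (i + 1)]) => z.
  by rewrite /active /=; case: (occ _ i); case: (occ _ _); auto.
rewrite -!(prob_empty mxi xi_law).
apply: (cover [set z | active z i] [set z | ~~ occ z i]
  [set z | ~~ occ z (i + 1)]) => z.
by rewrite /active /=; case: (occ _ i); case: (occ _ _); auto.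
Qed.

Lemma esum_active_fin :
  (\esum_(i in [set: int]) P [set w | active (xi w) i] < +oo)%E.
Proof.
have fin (a : nat -> \bar R) (K : R) : 0 <= K ->
    (forall n, a n <= (K * q ^+ n)%:E)%E -> (\esum_(n in setT) a n < +oo)%E.
  move=> K0 aK; apply: (@le_lt_trans _ _ (K%:E * (1 - q)^-1%:E)%E).
    apply: (@le_trans _ _ (\esum_(n in [set: nat]) (K%:E * (q ^+ n)%:E))%E).
      by apply: le_esum => n _; rewrite -EFinM.
    rewrite esumZl//; last by move=> n; rewrite lee_fin exprn_ge0// ltW.
    by rewrite lee_wpmul2l ?lee_fin// geometric_esum_le.
  by rewrite -EFinM ltry.
have f0 := fugacity_gt0 c q_gt0 0; have f1 := fugacity_gt0 c q_gt0 1.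
have qn n : 0 < q ^+ n by exact: exprn_gt0.
apply: le_lt_trans (esum_int_le _) _ => //; apply: lte_add_pinfty.
  apply: (fin _ ((fug 0)^-1 + (fug 1)^-1)).
    by rewrite addr_ge0 ?invr_ge0 ?ltW.
  move=> n; apply: le_trans (prob_active_le n).2 _; rewrite /fug lee_fin mulrDl.
  apply: lerD; apply: le_trans (density_ge _) _.
    have := fugacity_sub c q_gt0 n n; rewrite subrr => -> .
    by rewrite invfM mulrAC mulVf ?mul1r// gt_eqF.
  have := fugacity_sub c q_gt0 n (n%:Z + 1).
  rewrite (_ : n%:Z + 1 - n%:Z = 1); last by lia.
  by move=> ->; rewrite invfM mulrAC mulVf ?mul1r// gt_eqF.
apply: (fin _ (fug 0 + fug 1)); first by rewrite addr_ge0 ?ltW.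
move=> n; apply: le_trans (prob_active_le _).1 _; rewrite /fug lee_fin mulrDl.
apply: lerD; apply: le_trans (density_le _) _.
  by rewrite -[- _]add0r fugacity_sub// mulrC.
by rewrite addrC fugacity_sub// mulrC.
Qed.

(** * Moments of the label of a particle at a given site *)

Section moments.
Variables (r : nat) (m : int).

Let theta := 1 - q ^+ r.

(* [(q ^+ r) ^+ label z m] with only the [N] sites left of [m] counted; its mean
   is a finite product, and the neglected particles vanish as [N] grows. *)
Let thin (N : nat) (z : Omega) : R :=
  \prod_(k < N) (1 - theta * (occ z (m - 1 - k%:Z))%:R).

Let theta_ge0 : 0 <= theta.
Proof. by rewrite subr_ge0 exprn_ile1// ltW. Qed.

Let qr_ge0 : 0 <= q ^+ r. Proof. by rewrite exprn_ge0// ltW. Qed.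

Let thin_ge0 N z : 0 <= thin N z.
Proof.
apply: prodr_ge0 => k _; rewrite /theta; have := qr_ge0.
by case: (occ _ _); rewrite ?mulr1 ?mulr0; lra.
Qed.

Let thin_le1 N z : thin N z <= 1.
Proof.
apply: prodr_ile1 => k _; rewrite /theta; have := qr_ge0; have := theta_ge0.
rewrite /theta; case: (occ _ _); rewrite ?mulr1 ?mulr0 => *; apply/andP.
  by split; lra.
by split; lra.
Qed.

Lemma thinE N z :
  (q ^+ r) ^+ label z m = (q ^+ r) ^+ label z (m - N%:Z) * thin N z.
Proof.
elim: N => [|N IH]; first by rewrite subr0 /thin big_ord0 mulr1.
rewrite IH /thin big_ord_recr /= mulrA mulrAC; congr (_ * _).
rewrite (_ : m - N%:Z = m - N.+1%:Z + 1) ?labelS; last by lia.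
rewrite exprD (_ : m - 1 - N%:Z = m - N.+1%:Z); last by lia.
by congr (_ * _); rewrite /theta; case: (occ _ _) => /=; ring.
Qed.

(** Induction on [N] for all [J]: the factor of [thin] at the new site [a] is 1, diminished by
    [theta] when [a] is occupied, and that event is absorbed by adding [a] to [J]. Independence
    enters at [N = 0]. *)
Lemma esum_thin N (J : {fset int}) :
  (forall k : nat, (k < N)%N -> m - 1 - k%:Z \notin J) ->
  \esum_(z in [set z | forall i, i \in J -> occ z i]) (mass z * thin N z)%:E =
  (\prod_(i <- J) dens i * \prod_(k < N) (1 - theta * dens (m - 1 - k%:Z)))%:E.
Proof.
elim: N J => [|N IH] J NJ.
  rewrite big_ord0 mulr1 -prodEFin.
  under [RHS]eq_bigr do rewrite -(prob_occ xi_law).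
  rewrite -(xi_law.1 J (fun _ => [set b | b])).
  rewrite (config_prob P mxi [set z | forall i, i \in J -> occ z i]).
  by apply: eq_esum => z _; rewrite /thin big_ord0 mulr1.
set a := m - 1 - N%:Z.
have aJ : a \notin J by exact: NJ.
have mass0 := config_mass_ge0 P xi.
pose I := [set z | forall i, i \in J -> occ z i].
have e : (\esum_(z in I) (mass z * thin N.+1 z)%:E +
    theta%:E * (\esum_(z in [set z | forall i, i \in (a |` J)%fset -> occ z i])
      (mass z * thin N z)%:E) =
    \esum_(z in I) (mass z * thin N z)%:E)%E.
  rewrite -esumZl//; last by move=> z; rewrite lee_fin mulr_ge0.
  rewrite (_ : [set z | forall i, i \in (a |` J)%fset -> _] =
    I `&` [set z | occ z a]); last first.
    apply/seteqP; split=> z /=.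
      move=> h; split => [i iJ|]; apply: h; first by rewrite !inE iJ orbT.
      by rewrite !inE eqxx.
    by move=> [h1 h2] i; rewrite !inE => /orP[/eqP ->//|/h1].
  rewrite esum_mkcondr -esumD.
  - apply: eq_esum => z _; rewrite /thin big_ord_recr /= -/a.
    case: ifPn; rewrite ?inE ?notin_setE /= => oz.
      by rewrite oz -EFinM -EFinD /=; congr _%:E; ring.
    by rewrite (negPf (introN idP oz)) adde0 /=; congr _%:E; ring.
  - by move=> z _; rewrite lee_fin mulr_ge0.
  - by move=> z _; case: ifP => // _; rewrite -EFinM lee_fin !mulr_ge0.
have NJ' k : (k < N)%N -> m - 1 - k%:Z \notin J.
  by move=> kN; apply: NJ; exact: ltnW.
have NaJ k : (k < N)%N -> m - 1 - k%:Z \notin (a |` J)%fset.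
  move=> kN; rewrite !inE negb_or NJ' // andbT; apply/eqP; rewrite /a; lia.
move: e; rewrite (IH _ NJ') (IH _ NaJ) -EFinM => e.
move/eadd_eqE: e => ->; congr _%:E; rewrite big_fsetU1//= big_ord_recr /= -/a.
by ring.
Qed.

(** The mean of [thin] telescopes: the site at index [k] contributes [(1 + q ^+ (k + r).+1 * fug m)
    / (1 + q ^+ k.+1 * fug m)], which leaves [r] factors at either end, [shifted_prod N] above and
    [shifted_prod 0] below. *)
Let shifted_prod (N : nat) : R := \prod_(s < r) (1 + q ^+ (N + s).+1 * fug m).

Let factor_gt0 n : 0 < 1 + q ^+ n * fug m.
Proof.
by rewrite addr_gt0// mulr_gt0 ?exprn_gt0//; exact: fugacity_gt0.
Qed.

Let shifted_prod_gt0 N : 0 < shifted_prod N.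
Proof. exact: prodr_gt0. Qed.

Let shifted_prodS N : shifted_prod N.+1 * (1 + q ^+ N.+1 * fug m) =
  shifted_prod N * (1 + q ^+ (N + r).+1 * fug m).
Proof.
have -> : shifted_prod N * (1 + q ^+ (N + r).+1 * fug m) =
    \prod_(s < r.+1) (1 + q ^+ (N + s).+1 * fug m) by rewrite big_ord_recr.
rewrite big_ord_recl /= addn0 mulrC; congr (_ * _).
by apply: eq_bigr => s _; rewrite /bump /= add1n addnS addSn.
Qed.

Let thin_density N :
  \prod_(k < N) (1 - theta * dens (m - 1 - k%:Z)) =
  shifted_prod N / shifted_prod 0.
Proof.
elim: N => [|N IH]; first by rewrite big_ord0 divff// gt_eqF.
have s0 := shifted_prod_gt0 0; have f1 := factor_gt0 N.+1.
rewrite big_ord_recr /= IH.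
have -> : shifted_prod N.+1 =
    shifted_prod N * (1 + q ^+ (N + r).+1 * fug m) / (1 + q ^+ N.+1 * fug m).
  by rewrite -shifted_prodS mulfK// gt_eqF.
have -> : dens (m - 1 - N%:Z) =
    q ^+ N.+1 * fug m / (1 + q ^+ N.+1 * fug m).
  rewrite /dens /density (_ : m - 1 - N%:Z = m - N.+1%:Z); last by lia.
  by rewrite fugacity_sub.
have -> : q ^+ (N + r).+1 = q ^+ N.+1 * q ^+ r by rewrite -exprD addSn.
by rewrite /theta; field; rewrite !gt_eqF.
Qed.

Let shifted_prod_cvg : shifted_prod N @[N --> \oo] --> (1 : R).
Proof.
rewrite /shifted_prod; elim: r => [|n IH].
  by under eq_fun do rewrite big_ord0; exact: cvg_cst.
under eq_fun do rewrite big_ord_recr /=.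
have factor_cvg : 1 + q ^+ (N + n).+1 * fug m @[N --> \oo] --> (1 : R).
  have qN : (GRing.exp q : R ^nat) N @[N --> \oo] --> (0 : R).
    by apply: cvg_expr; rewrite gtr0_norm.
  under eq_fun do rewrite -addnS exprD -mulrA.
  have := cvgD (cvg_cst (1 : R)) (cvgMr_tmp (b := q ^+ n.+1 * fug m) qN).
  by rewrite mul0r addr0 => h; exact: h.
by have := cvgM IH factor_cvg; rewrite mulr1 => h; exact: h.
Qed.

Let mass_ge0 z : 0 <= mass z. Proof. exact: config_mass_ge0. Qed.

(** Bounds the error made by counting [N] sites only: unless a particle lies left of [m - N],
    [thin N] is exact. *)
Let escape (N : nat) : R :=
  fine (P [set w | (0 < label (xi w) (m - N%:Z)%R)%N]).

(** Every configuration is empty far to the left, so the events decrease to the empty set. *)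
Let escape_cvg : escape N @[N --> \oo] --> (0 : R).
Proof.
pose F N := xi @^-1` [set z | (0 < label z (m - N%:Z)%R)%N].
have F0 : \bigcap_N F N = set0.
  apply/seteqP; split => // w Fw; have [n [hn _]] := omega_bounded (xi w).
  have := Fw `|(m + n%:Z)%R|%N I; rewrite /F /= label_eq0// => k hk; apply: hn.
  by lia.
have := @nonincreasing_cvg_mu _ _ _ P F.
rewrite F0 measure0 => /(_ _ _ _ _)/fine_cvg; apply => //.
- exact: le_lt_trans (probability_le1 _ (mxi _)) (ltry _).
- by move=> N; exact: mxi.
- move=> N M NM; rewrite subsetEset => w /= h; apply: leq_trans h _.
  by apply: label_le; lia.
Qed.

(** The mean with [thin N] lies between the moment and the moment plus [escape N], and its explicit
    value converges since [shifted_prod N] tends to 1. *)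
Lemma esum_label_moment :
  \esum_(z in [set z | occ z m]) (mass z * (q ^+ r) ^+ label z m)%:E =
  (dens m / \prod_(s < r) (1 + q ^+ s.+1 * fug m))%:E.
Proof.
set X := esum _ _.
have L N : \esum_(z in [set z | occ z m]) (mass z * thin N z)%:E =
    (dens m * (shifted_prod N / shifted_prod 0))%:E.
  have := @esum_thin N [fset m]%fset; rewrite big_seq_fset1 thin_density => <-.
    congr esum; apply/seteqP; split => z /=; last by apply; rewrite inE.
    by move=> h i; rewrite inE => /eqP ->.
  by move=> k _; rewrite inE; apply/eqP; lia.
have X0 : (0 <= X)%E.
  by apply: esum_ge0 => z _; rewrite lee_fin mulr_ge0// exprn_ge0.
have upper N : (X <= (dens m * (shifted_prod N / shifted_prod 0))%:E)%E.
  rewrite -L; apply: le_esum => z _; rewrite lee_fin ler_wpM2l// (thinE N).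
  rewrite ler_piMl// exprn_ile1// exprn_ile1// ltW//.
have Xfin : X \is a fin_num.
  by rewrite ge0_fin_numE// (le_lt_trans (upper 0%N)) ?ltry.
have lower N : ((dens m * (shifted_prod N / shifted_prod 0))%:E <=
    X + (escape N)%:E)%E.
  rewrite -L /escape fineK; last first.
    exact: (fin_num_measure P _ (mxi [set z | (0 < label z (m - N%:Z)%R)%N])).
  apply: (@le_trans _ _ (\esum_(z in [set z | occ z m])
    ((mass z * (q ^+ r) ^+ label z m)%:E +
     (mass z * (0 < label z (m - N%:Z)%R)%N%:R)%:E))%E).
    apply: le_esum => z _; rewrite -EFinD lee_fin -mulrDr ler_wpM2l//.
    case: (posnP (label z _)) => h.
      by rewrite (thinE N) h expr0 mul1r addr0.
    by rewrite (le_trans (thin_le1 _ _))// lerDr exprn_ge0.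
  rewrite esumD; last first.
  - by move=> z _; rewrite lee_fin mulr_ge0.
  - by move=> z _; rewrite lee_fin mulr_ge0// exprn_ge0.
  rewrite leeD2l// (config_prob P mxi [set z | (0 < label z (m - N%:Z)%R)%N]).
  rewrite esum_mkcond [leRHS]esum_mkcond; apply: le_esum => z _.
  rewrite mem_setE.
  case: ifP => _; case: ifPn; rewrite ?inE ?notin_setE /= => h.
  - by rewrite h mulr1.
  - by rewrite (negPf (introN idP h)) mulr0.
  - by rewrite lee_fin.
  - by [].
have cvgX : dens m * (shifted_prod N / shifted_prod 0) @[N --> \oo] --> fine X.
  apply: (@squeeze_cvgr _ _ _ _ (fun=> fine X) (fun N => fine X + escape N)).
  - apply: nearW => N; rewrite -!lee_fin EFinD fineK//.
    by rewrite upper lower.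
  - exact: cvg_cst.
  - by have := cvgD (cvg_cst (fine X)) escape_cvg; rewrite addr0 => h; exact: h.
rewrite -(fineK Xfin); congr _%:E; apply: (cvg_unique _ cvgX) => //.
have -> : dens m / \prod_(s < r) (1 + q ^+ s.+1 * fug m) =
  dens m * (1 / shifted_prod 0) by rewrite mul1r.
by apply: cvgMl_tmp; apply: cvgMr_tmp.
Qed.

End moments.

End blocking_measure_sums.

(** * Rates of the coupled system *)

Section coupled_rates.
Context {R : realType} (q : R).
Hypotheses (q_gt0 : 0 < q) (q_lt1 : q < 1).
Variable d : nat.

Lemma asep_rate_ge0 z z' : 0 <= asep_rate q z z'.
Proof. by rewrite addr_ge0// mulr_ge0// ltW. Qed.

Lemma label_rate_ge0 z (x x' : Zplus d) : 0 <= label_rate q z x x'.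
Proof. by rewrite addr_ge0// mulr_ge0// ltW. Qed.

Lemma coupled_rate_ge0 (s s' : coupled_state d) : 0 <= coupled_rate q s s'.
Proof.
by rewrite addr_ge0// mulr_ge0//; [exact: asep_rate_ge0|exact: label_rate_ge0].
Qed.

Lemma label_jump_up z (x x' : Zplus d) k : label_jump z x x' k k.+1 ->
  label_jump z x' x k.+1 k /\ exists j, raise x x' j.
Proof.
move=> [dist [j [xj xN x'E]]]; split; last first.
  by exists j; rewrite /raise xj.
split; first by rewrite distrC.
exists j; split => [|i|i].
- by rewrite x'E eqxx.
- rewrite x'E; case: (eqVneq i j) => [_|ij]; first by lia.
  by rewrite -xj; apply: contra ij => /eqP/crd_inj ->.
- by case: (eqVneq i j) => [->|ij]; rewrite ?xj// x'E (negPf ij).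
Qed.

Lemma label_jump_down z (x x' : Zplus d) k : label_jump z x x' k.+1 k ->
  label_jump z x' x k k.+1.
Proof.
move=> [dist [j [xj xN x'E]]].
split; first by rewrite distrC.
exists j; split => [|i|i].
- by rewrite x'E eqxx.
- rewrite x'E; case: (eqVneq i j) => [_|ij]; first by lia.
  by rewrite -xj; apply: contra ij => /eqP/crd_inj ->.
- by case: (eqVneq i j) => [->|ij]; rewrite ?xj// x'E (negPf ij).
Qed.

(** An upward move has rate [q] and multiplies the weight by [q], the move that undoes it has rate
    1, and both require the same two particles to be neighbours. *)
Lemma label_rate_balance z (x x' : Zplus d) :
  label_weight q x * label_rate q z x x' =
  label_weight q x' * label_rate q z x' x.
Proof.
have up_down (y y' : Zplus d) :
    label_weight q y * (q * `[< exists k, label_jump z y y' k k.+1 >]%:R) =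
    label_weight q y' * `[< exists k, label_jump z y' y k.+1 k >]%:R.
  case: asboolP => [[k /label_jump_up[yk [j yj]]]|no].
    rewrite asboolT; last by exists k.
    by rewrite (label_weight_raise q yj) !mulr1 mulrC.
  rewrite asboolF ?mulr0// => -[k /label_jump_down yk]; apply: no.
  by exists k.
by rewrite /label_rate !mulrDr !up_down addrC.
Qed.

Lemma asep_rate_balance (mass : Omega -> R) z z' :
  (forall z z' i, particle_jump z z' i (i + 1) -> mass z = q * mass z') ->
  mass z * asep_rate q z z' = mass z' * asep_rate q z' z.
Proof.
move=> bal.
have right_left y y' :
    mass y * `[< exists i, particle_jump y y' i (i + 1) >]%:R =
    mass y' * (q * `[< exists i, particle_jump y' y (i + 1) i >]%:R).
  case: asboolP => [[i yi]|no].
    rewrite asboolT; last by exists i; exact: particle_jump_rev.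
    by rewrite (bal _ _ _ yi) !mulr1 mulrC.
  rewrite asboolF ?mulr0// => -[i /particle_jump_rev yi]; apply: no.
  by exists i.
by rewrite /asep_rate !mulrDr !right_left addrC.
Qed.

(** Jumps are summed over bonds instead of targets, rates being at most 1. A bond and a direction
    determine at most one target, and none if the bond is not active. *)
Lemma asep_exit_le z : (\esum_(z' in setT) (asep_rate q z z')%:E <=
  \esum_(i in [set: int]) (2 * (active z i)%:R)%:E)%E.
Proof.
pose J i z' : R := `[< particle_jump z z' i (i + 1) >]%:R +
  `[< particle_jump z z' (i + 1) i >]%:R.
have J0 i z' : 0 <= J i z' by rewrite addr_ge0.
apply: (@le_trans _ _
    (\esum_(z' in setT) \esum_(i in [set: int]) (J i z')%:E)%E).
  apply: le_esum => z' _.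
  apply: (@le_trans _ _ ((`[< exists i, particle_jump z z' i (i + 1) >]%:R)%:E +
    (`[< exists i, particle_jump z z' (i + 1) i >]%:R)%:E)%E).
    by rewrite -EFinD lee_fin lerD2l ler_piMl// ltW.
  under [leRHS]eq_esum do rewrite EFinD.
  rewrite esumD//; apply: leeD; case: asboolP => [[i ji]|_];
    try exact: esum_ge0.
    apply: le_trans (esum_ge_term _ (i := i) _) => //.
    by rewrite asboolT.
  apply: le_trans (esum_ge_term _ (i := i) _) => //.
  by rewrite asboolT.
rewrite esum_exchange; last by move=> *; rewrite lee_fin.
apply: le_esum => i _; rewrite /active.
under eq_esum do rewrite EFinD.
rewrite esumD//.
case: (eqVneq (occ z i) (occ z (i + 1))) => [e|_] /=.
  rewrite !esum1 ?adde0 ?mulr0// => z' _; rewrite asboolF// => -[oi oj _];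
  by move: oi oj; rewrite e => ->.
rewrite mulr1 (_ : 2%:E = (1 + 1)%E)//; apply: leeD; apply: esum_le1 => y y'.
  exact: particle_jump_uniq.
exact: particle_jump_uniq.
Qed.

(** For an upper bound the conditions on sites and free values are dropped; each label then has at
    most one upward and one downward target. *)
Lemma label_exit_le z (x : Zplus d) :
  (\esum_(x' in setT) (label_rate q z x x')%:E <= (2 * d%:R)%:E)%E.
Proof.
(* At a label 0, [predn] gives 0 again; this spurious target only enlarges the upper bound. *)
pose U (l : nat -> nat) j (x' : Zplus d) : Prop :=
  forall i, crd x' i = if i == j then l (crd x j) else crd x i.
pose J j x' : R := `[< U S j x' >]%:R + `[< U predn j x' >]%:R.
have J0 j x' : 0 <= J j x' by rewrite addr_ge0.
apply: (@le_trans _ _ (\esum_(x' in setT) \sum_(j < d) (J j x')%:E)%E).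
  apply: le_esum => x' _; rewrite sumEFin lee_fin big_split /=.
  have sumge0 l : 0 <= \sum_(j < d) (`[< U l j x' >]%:R : R) by exact: sumr_ge0.
  apply: lerD.
    rewrite -[leRHS]mul1r; case: asboolP => [[k [_ [j [xj _ x'E]]]]|_].
      rewrite mulr1 mul1r (bigD1 j)//= asboolT; last by move=> i; rewrite xj.
      rewrite (le_trans (ltW q_lt1))// lerDl sumr_ge0//.
    by rewrite mulr0 mul1r.
  case: asboolP => [[k [_ [j [xj _ x'E]]]]|_]; last exact: sumge0.
  rewrite (bigD1 j)//= asboolT; last by move=> i; rewrite xj.
  by rewrite lerDl sumr_ge0.
rewrite esum_sum; last by move=> *; rewrite lee_fin.
apply: (@le_trans _ _ (\sum_(j < d) 2%:E)%E); last first.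
  by rewrite sumEFin lee_fin big_const_ord iter_addr_0 mulr_natr.
apply: lee_sum => j _; under eq_esum do rewrite EFinD.
rewrite esumD// (_ : 2%:E = (1 + 1)%E)//.
by apply: leeD; apply: esum_le1 => y y' hy hy'; apply: crd_ext => i;
  rewrite hy hy'.
Qed.

Lemma coupled_exit_le (s : coupled_state d) :
  (\esum_(s' in setT) (coupled_rate q s s')%:E <=
   \esum_(i in [set: int]) (2 * (active s.1 i)%:R)%:E + (2 * d%:R)%:E)%E.
Proof.
case: s => z x /=; rewrite esum_pair; last first.
  by move=> *; rewrite lee_fin coupled_rate_ge0.
have a0 z' x' : 0 <= (x' == x)%:R * asep_rate q z z'.
  by rewrite mulr_ge0// asep_rate_ge0.
have l0 z' x' : 0 <= (z' == z)%:R * label_rate q z x x'.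
  by rewrite mulr_ge0// label_rate_ge0.
have delta (T : choiceType) (y : T) :
    (\esum_(y' in setT) ((y' == y)%:R : R)%:E <= 1)%E.
  apply: le_trans (@esum_le1 R T setT (fun y' => y' = y) _); last first.
    by move=> ? ? -> ->.
  apply: le_esum => y' _.
  by case: eqP => [->|ne]; [rewrite asboolT|rewrite asboolF].
rewrite /coupled_rate /=.
apply: (@le_trans _ _ (\esum_(z' in setT) ((asep_rate q z z')%:E +
   ((z' == z)%:R)%:E * \esum_(x' in setT) (label_rate q z x x')%:E))%E).
  apply: le_esum => z' _; rewrite [leLHS](@eq_esum _ _ _ _ (fun x' =>
    ((asep_rate q z z')%:E * ((x' == x)%:R)%:E +
     ((z' == z)%:R)%:E * (label_rate q z x x')%:E)%E)); last first.
    by move=> x' _; rewrite -!EFinM -EFinD mulrC.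
  rewrite esumD; last 2 first.
  - by move=> x' _; rewrite -EFinM lee_fin mulrC; exact: a0.
  - by move=> x' _; rewrite -EFinM lee_fin; exact: l0.
  apply: leeD; last first.
    by rewrite esumZl// => x'; rewrite lee_fin label_rate_ge0.
  rewrite esumZl//; last exact: asep_rate_ge0.
  by rewrite -[leRHS]mule1 lee_wpmul2l ?lee_fin ?asep_rate_ge0.
rewrite esumD; last 2 first.
- by move=> *; rewrite lee_fin asep_rate_ge0.
- move=> *; rewrite mule_ge0 ?lee_fin// esum_ge0// => *.
  by rewrite lee_fin label_rate_ge0.
apply: leeD; first exact: asep_exit_le.
have fin : (\esum_(x' in setT) (label_rate q z x x')%:E)%E \is a fin_num.
  rewrite ge0_fin_numE; first exact: le_lt_trans (label_exit_le _ _) (ltry _).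
  by apply: esum_ge0 => *; rewrite lee_fin label_rate_ge0.
apply: le_trans (label_exit_le z x); rewrite -(fineK fin).
under eq_esum do rewrite muleC.
have f0 : 0 <= fine (\esum_(x' in setT) (label_rate q z x x')%:E).
  by rewrite fine_ge0// esum_ge0// => *; rewrite lee_fin label_rate_ge0.
by rewrite esumZl// -[leRHS]mule1 lee_wpmul2l ?lee_fin.
Qed.

Lemma label_weight_gt0 (x : Zplus d) : 0 < label_weight q x.
Proof. by apply: prodr_gt0 => j _; rewrite exprn_gt0. Qed.

End coupled_rates.

(** * The stationary law *)

Section stationary_coupling.
Context {R : realType} (q c : R).
Hypotheses (q_gt0 : 0 < q) (q_lt1 : q < 1).
Variable d : nat.
Context {disp : measure_display} {T : measurableType disp}.
Variables (P : probability T R) (S : R -> T -> coupled_state d).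
Hypothesis hS : markov_jump_process (@coupled_rate R q d) P S.
Hypothesis S_stationary : stationary P S.
Variables (t : R) (t_ge0 : 0 <= t).

Let xi (w : T) : Omega := (S t w).1.

Hypothesis xi_law : blocking_law q c P xi.

Let mass : Omega -> R := config_mass P xi.
Let pi : coupled_state d -> R := point_mass P S t.
Let lam (s : coupled_state d) : R := mass s.1 * label_weight q s.2.
Let w (s s' : coupled_state d) : R :=
  (s != s')%:R * (lam s * coupled_rate q s s').
Let f (s : coupled_state d) : R := pi s / lam s.

Let mxi (A : set Omega) : measurable (xi @^-1` A).
Proof. exact: (mjp_measurable hS [set s | A s.1] t_ge0). Qed.

Let mass_ge0 z : 0 <= mass z. Proof. exact: config_mass_ge0. Qed.

Let mass_balance z z' i : particle_jump z z' i (i + 1) ->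
  mass z = q * mass z'.
Proof. exact: (config_mass_balance q_gt0 mxi xi_law). Qed.

Let lam_ge0 s : 0 <= lam s.
Proof. by rewrite mulr_ge0// ltW// label_weight_gt0. Qed.

Let w_ge0 s s' : 0 <= w s s'.
Proof.
by apply: mulr_ge0 => //; apply: mulr_ge0 => //; exact: coupled_rate_ge0.
Qed.

Let w_sym s s' : w s s' = w s' s.
Proof.
rewrite /w eq_sym; congr (_ * _); case: s s' => [z x] [z' x'].
rewrite /lam /coupled_rate /= mulrDr [in RHS]mulrDr.
rewrite (eq_sym x' x) (eq_sym z' z); congr (_ + _).
  have [->|_] := eqVneq x x'; last by rewrite !mul0r !mulr0.
  rewrite !mul1r ![_ * label_weight q _]mulrC -!mulrA; congr (_ * _).
  exact: (asep_rate_balance _ _ mass_balance).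
have [->|_] := eqVneq z z'; last by rewrite !mul0r !mulr0.
by rewrite !mul1r -!mulrA label_rate_balance.
Qed.

Let pi_le s : pi s <= mass s.1.
Proof.
rewrite -lee_fin (point_massE hS t_ge0) config_massE//; apply: le_measure.
- by rewrite inE; exact: (state_measurable hS t_ge0).
- by rewrite inE; exact: mxi.
- by move=> y /= <-.
Qed.

(** Division by 0 gives 0, so the case [lam s = 0] is separate: [mass] vanishes there, and [pi] with
    it. *)
Let lam_f s : lam s * f s = pi s.
Proof.
rewrite /f; have [l0|l0] := eqVneq (lam s) 0; last by rewrite mulrC divfK.
rewrite l0 mul0r; apply/esym/eqP; rewrite eq_le point_mass_ge0 andbT.
apply: le_trans (pi_le s) _; move: l0 => /eqP; rewrite mulf_eq0.
by rewrite (gt_eqF (label_weight_gt0 q_gt0 _)) orbF => /eqP ->.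
Qed.

Let f_ge0 s : 0 <= f s.
Proof. by rewrite divr_ge0// point_mass_ge0. Qed.

(** The bound [B] on the exit rate depends on the configuration only, so the total flow is at most
    the mean of [B] times [subset_sum q d]; that mean is finite by the summability of the active
    bonds. *)
Let w_fin : (\esum_(s in setT) \esum_(s' in setT) (w s s')%:E < +oo)%E.
Proof.
pose B z := (\esum_(i in [set: int]) (2 * (active z i)%:R : R)%:E +
  (2 * d%:R)%:E)%E.
have B0 z : (0 <= B z)%E.
  by rewrite adde_ge0 ?lee_fin// esum_ge0// => i _; rewrite lee_fin.
have lw0 (x : Zplus d) : 0 <= label_weight q x.
  exact: ltW (label_weight_gt0 q_gt0 x).
pose Y := (\esum_(z in [set: Omega]) ((mass z)%:E * B z))%E.
have Y0 : (0 <= Y)%E by apply: esum_ge0 => z _; rewrite mule_ge0 ?lee_fin.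
have Yfin : (Y < +oo)%E.
  rewrite /Y /B (@eq_esum _ _ _ _ (fun z =>
      \esum_(i in [set: int]) ((mass z * (2 * (active z i)%:R))%:E) +
      (2 * d%:R)%:E * (mass z)%:E)%E); last first.
    move=> z _; rewrite ge0_muleDr ?lee_fin//; last first.
      by apply: esum_ge0 => i _; rewrite lee_fin.
    by rewrite -esumZl// [X in _ = (_ + X)%E]muleC; congr (_ + _)%E.
  rewrite esumD; last 2 first.
  - by move=> z _; apply: esum_ge0 => i _; rewrite lee_fin mulr_ge0.
  - by move=> z _; rewrite -EFinM lee_fin mulr_ge0.
  apply: lte_add_pinfty; last first.
    rewrite esumZl// -(config_prob P mxi setT) preimage_setT probability_setT.
    by rewrite mule1 ltry.
  rewrite esum_exchange; last by move=> *; rewrite lee_fin mulr_ge0.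
  rewrite (@eq_esum _ _ _ _ (fun i => 2%:E * P [set w | active (xi w) i])%E).
    rewrite esumZl//; apply: lte_mul_pinfty => //.
    exact: (esum_active_fin q_gt0 q_lt1 mxi xi_law).
  move=> i _; rewrite (config_prob P mxi [set z | active z i]) -esumZl//.
  rewrite [RHS]esum_mkcond; apply: eq_esum => z _.
  case: ifPn; rewrite ?inE ?notin_setE /= => h.
    by rewrite h mulr1 -EFinM mulrC.
  by rewrite (negPf (introN idP h)) !mulr0.
apply: (@le_lt_trans _ _ (Y * subset_sum q d)%E); last first.
  have Yn : Y \is a fin_num by rewrite ge0_fin_numE.
  rewrite -(fineK Yn) -(fineK (subset_sum_fin_num q_gt0 q_lt1 d)) -EFinM.
  exact: ltry.
apply: (@le_trans _ _ (\esum_(s in [set: coupled_state d])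
   ((label_weight q s.2)%:E * ((mass s.1)%:E * B s.1)))%E).
  apply: le_esum => s _.
  apply: (@le_trans _ _ (\esum_(s' in setT)
     ((lam s)%:E * (coupled_rate q s s')%:E))%E).
    apply: le_esum => s' _; rewrite -EFinM lee_fin /w.
    by rewrite ler_piMl ?mulr_ge0 ?coupled_rate_ge0//; case: (_ != _).
  rewrite esumZl//; last by move=> s'; rewrite lee_fin coupled_rate_ge0.
  rewrite muleA -EFinM [(label_weight _ _ * _)%R]mulrC -/(lam s).
  by rewrite lee_wpmul2l ?lee_fin// coupled_exit_le.
rewrite esum_pair /=; last first.
  by move=> s; rewrite mule_ge0 ?lee_fin// mule_ge0 ?lee_fin.
rewrite esum_exchange; last first.
  by move=> *; rewrite mule_ge0 ?lee_fin// mule_ge0 ?lee_fin.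
have Yn : Y \is a fin_num by rewrite ge0_fin_numE.
rewrite -esum_label_weight -(fineK Yn) -esumZl ?fine_ge0//.
apply: le_esum => x _; rewrite esumZl//; last first.
  by move=> z; rewrite mule_ge0 ?lee_fin.
by rewrite -/Y (fineK Yn) muleC.
Qed.

(** By reversibility [w s s' * f s'] is the flow of [pi] from [s'] into [s], so this is
    subinvariance of [pi] divided by [lam]. *)
Let f_super s : (\esum_(s' in setT) (w s s' * f s')%:E <=
  (f s)%:E * \esum_(s' in setT) (w s s')%:E)%E.
Proof.
apply: (@le_trans _ _
    (\esum_(s' in [set~ s]) (pi s' * coupled_rate q s' s)%:E)%E).
  rewrite [leRHS]esum_mkcond; apply: le_esum => s' _; rewrite w_sym /w.
  case: (eqVneq s' s) => [->|ss']; rewrite /= ?mul0r.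
    case: ifP => // _.
    by rewrite lee_fin mulr_ge0 ?coupled_rate_ge0 ?point_mass_ge0.
  rewrite mul1r ifT; last by rewrite inE /=; apply/eqP.
  by rewrite mulrAC lam_f.
apply: le_trans (point_mass_subinvariant hS S_stationary t_ge0 s) _.
rewrite -/(pi s) -lam_f [(lam s * _)%R]mulrC EFinM -muleA.
rewrite lee_wpmul2l ?lee_fin// -esumZl//; last first.
  by move=> s'; rewrite lee_fin coupled_rate_ge0.
rewrite esum_mkcond; apply: le_esum => s' _; case: ifPn.
  rewrite inE /= => /eqP ss'; rewrite /w eq_sym ss' mul1r EFinM.
  exact: lexx.
by move=> _; rewrite lee_fin.
Qed.

Let f_edge s s' : s != s' -> 0 < mass s.1 -> 0 < coupled_rate q s s' ->
  f s = f s'.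
Proof.
move=> ss' ms rs; apply: (superharmonic_const w_ge0 w_sym w_fin f_ge0 f_super).
by rewrite /w ss' mul1r !mulr_gt0// label_weight_gt0.
Qed.

Let f_jump z z' i x : particle_jump z z' i (i + 1) -> 0 < mass z ->
  f (z, x) = f (z', x).
Proof.
move=> zz' mz; have [oi _ zE] := zz'.
have ne : z != z' by apply: contraTneq oi => ->; rewrite zE eqxx.
apply: f_edge => //=; first by rewrite xpair_eqE negb_and ne.
rewrite /coupled_rate /= eqxx eq_sym (negPf ne) mul1r mul0r addr0.
rewrite /asep_rate asboolT; last by exists i.
by rewrite ltr_wpDr// mulr_ge0// ltW.
Qed.

(** Induction on the gap between the particles with labels [l] and [l.+1]. In contact, the label
    move is an allowed transition; otherwise an ASEP jump narrows the gap, and it changes [f]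
    neither with labels [x] nor with labels [x']. *)
Let f_raise z x x' j : 0 < mass z -> raise x x' j -> f (z, x) = f (z, x').
Proof.
move=> mz xx'; set l := crd x j.
have [n hn] : exists n : nat, site z l.+1 = site z l + 1 + n%:Z.
  by have := site_lt z l; exists `|(site z l.+1 - (site z l + 1))%R|%N; lia.
elim: n z mz hn => [|n IH] z mz hn.
  have ne : x != x'.
    apply/eqP => e; have := xx'.1 j; have := xx'.2 j.
    by rewrite -e !eqxx => h; rewrite {1}h eqxx.
  apply: f_edge => //=; first by rewrite xpair_eqE eqxx.
  rewrite /coupled_rate /= eqxx eq_sym (negPf ne) mul0r add0r mul1r.
  rewrite /label_rate asboolT; first by rewrite ltr_wpDr// mulr1.
  exists l; split; first by rewrite hn addr0 addrAC subrr add0r normr1.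
  by exists j; split => //; [exact: xx'.1|exact: xx'.2].
have [|z' [zz' s1 s2]] := @close_gap z l; first by rewrite hn; lia.
rewrite (f_jump x zz')// (f_jump x' zz')//; apply: IH; last by lia.
by move: mz; rewrite (mass_balance zz') pmulr_rgt0.
Qed.

Let pi_marginal z :
  (\esum_(x in [set: Zplus d]) (pi (z, x))%:E = (mass z)%:E)%E.
Proof.
have [g g_inj] := coupled_state_inj d.
rewrite config_massE//.
transitivity (P (S t @^-1` [set s | s.1 = z])); last by [].
rewrite (prob_esum P (state_measurable hS t_ge0) [set s | s.1 = z] g_inj).
rewrite (reindex_esum [set: Zplus d] _ (fun x => (z, x))); last first.
  by split => [//|x x' _ _ []//|[z' x] /= ->]; exists x.
by apply: eq_esum => x _; exact: (point_massE hS t_ge0).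
Qed.

(** For fixed [z] of positive mass, [f] is constant in the labels, so [pi] is proportional to
    [label_weight]; the marginal [mass z] fixes the constant. *)
Lemma point_mass_product z x : point_mass P S t (z, x) =
  config_mass P xi z * label_weight q x / fine (subset_sum q d).
Proof.
rewrite -/(pi _) -/(mass z).
have [m0|m0] := eqVneq (mass z) 0.
  rewrite m0 !mul0r; apply/eqP; rewrite eq_le point_mass_ge0 andbT.
  by rewrite -m0; exact: (pi_le (z, x)).
have mz : 0 < mass z by rewrite lt_neqAle eq_sym m0 mass_ge0.
have fE y : f (z, y) = f (z, x).
  apply: (@raise_connected d R (fun y => f (z, y))) => y1 y2 j yy.
  exact: f_raise yy.
have := pi_marginal z.
rewrite (@eq_esum _ _ _ _ (fun y =>
  ((mass z * f (z, x))%:E * (label_weight q y)%:E)%E)); last first.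
  by move=> y _; rewrite -EFinM -lam_f fE /lam /= mulrAC.
rewrite esumZl; last 2 first.
- by rewrite mulr_ge0.
- by move=> y; rewrite lee_fin ltW// label_weight_gt0.
rewrite esum_label_weight -(fineK (subset_sum_fin_num q_gt0 q_lt1 d)) -EFinM.
case=> total; have Z0 := subset_sum_gt0 q_gt0 q_lt1 d.
have e : f (z, x) * fine (subset_sum q d) = 1.
  by apply: (mulfI m0); rewrite mulrA total mulr1.
rewrite -lam_f /lam /=; congr (_ * _).
by apply: (mulIf (lt0r_neq0 Z0)); rewrite e mulVf// lt0r_neq0.
Qed.

End stationary_coupling.

(** * Occupation probabilities *)

Section occupied_labels.
Context {R : realType} (q c : R).
Hypotheses (q_gt0 : 0 < q) (q_lt1 : q < 1).
Context {disp : measure_display} {T : measurableType disp}.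
Variables (P : probability T R) (xi : T -> Omega).
Hypothesis mxi : forall A : set Omega, measurable (xi @^-1` A).
Hypothesis xi_law : blocking_law q c P xi.
Variable m : int.

Let y := fugacity q c m.
Let occupied : set Omega := [set z | occ z m].
Let moment (r : nat) : R := density q c m / \prod_(s < r) (1 + q ^+ s.+1 * y).

(** Induction on [d] for all [r]: the recursion of [subset_sum_in] at [k = label z m] carries a
    factor [q ^+ k], which turns [r] into [r.+1]. This is why the statement covers every [r],
    although [r = 0] is the final target. *)
Lemma esum_occupied_label (d r : nat) :
  \esum_(z in occupied)
    ((config_mass P xi z * (q ^+ r) ^+ label z m)%:E *
     subset_sum_in q d (label z m))%E =
  (moment r * (1 - q ^+ d) / (1 + q ^+ (d + r) * y) *
     fine (subset_sum q d))%:E.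
Proof.
have y0 : 0 < y := fugacity_gt0 c q_gt0 m.
have fac n : 0 < 1 + q ^+ n * y by rewrite addr_gt0// mulr_gt0// exprn_gt0.
have mass0 z : 0 <= config_mass P xi z by exact: config_mass_ge0.
have qr0 r' z : 0 <= (q ^+ r') ^+ label z m by rewrite !exprn_ge0// ltW.
elim: d r => [|d IH] r.
  rewrite subrr mulr0 !mul0r; apply: esum1 => z _.
  by rewrite subset_sum_in0 mule0.
have momentS : moment r = moment r.+1 * (1 + q ^+ r.+1 * y).
  rewrite /moment big_ord_recr /= invfM mulrA divfK// gt_eqF//.
have Z : fine (subset_sum q d.+1) =
    q ^+ d * fine (subset_sum q d) / (1 - q ^+ d.+1).
  rewrite -(subset_sum_rec q_gt0 q_lt1) mulrAC divff ?mul1r// subr_eq0 eq_sym.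
  by rewrite lt_eqF// exprn_ilt1// ltW.
have : (\esum_(z in occupied)
      ((config_mass P xi z * (q ^+ r) ^+ label z m)%:E *
        subset_sum_in q d.+1 (label z m)) +
    \esum_(z in occupied)
      ((config_mass P xi z * (q ^+ r.+1) ^+ label z m)%:E *
        subset_sum_in q d (label z m)) =
    (fine (subset_sum q d) * moment r.+1)%:E)%E.
  rewrite -esumD; last 2 first.
  - move=> z _; rewrite mule_ge0 ?subset_sum_in_ge0//.
    by rewrite lee_fin mulr_ge0.
  - move=> z _; rewrite mule_ge0 ?subset_sum_in_ge0//.
    by rewrite lee_fin mulr_ge0.
  rewrite EFinM -(esum_label_moment q_gt0 q_lt1 mxi xi_law).
  rewrite -esumZl; last 2 first.
  - by rewrite fine_ge0// subset_sum_ge0.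
  - by move=> z; rewrite lee_fin mulr_ge0.
  apply: eq_esum => z _; set k := label z m.
  have := subset_sum_in_rec q_gt0 d k.
  rewrite -(fineK (subset_sum_in_fin_num q_gt0 q_lt1 d k)).
  rewrite -(fineK (subset_sum_in_fin_num q_gt0 q_lt1 d.+1 k)).
  rewrite -(fineK (subset_sum_fin_num q_gt0 q_lt1 d)).
  rewrite -!EFinM -!EFinD => -[] e; congr _%:E.
  rewrite [q ^+ r.+1]exprSr exprMn.
  transitivity (config_mass P xi z * (q ^+ r) ^+ k *
    (fine (subset_sum_in q d.+1 k) + q ^+ k * fine (subset_sum_in q d k))).
    by ring.
  by rewrite e /=; ring.
rewrite IH => /eadd_eqE ->; congr _%:E; rewrite momentS Z addSnnS.
have := fac (d + r.+1)%N; have -> : q ^+ (d + r.+1) = q ^+ d * q ^+ r.+1.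
  by rewrite exprD.
have : 0 < 1 - q ^+ d.+1 by rewrite subr_gt0 exprn_ilt1// ltW.
move=> h1 h2; field; rewrite !gt_eqF//.
Qed.

End occupied_labels.

(** On occupied sites, [label] and [site] are inverse to each other, so a second class particle sits
    at [m] when the label of the particle at [m] is one of the coordinates. *)
Lemma second_class_at (d : nat) (s : coupled_state d) (m : int) :
  (eta_at s m < xi_at s m) =
  occ s.1 m && (label s.1 m \in label_set s.2).
Proof.
rewrite /eta_at ltrBlDr ltrDl.
have -> : (0 < \sum_(j < d) (m == site s.1 (crd s.2 j))%:Z) =
    [exists j, m == site s.1 (crd s.2 j)].
  apply/idP/existsP => [|[j mj]]; last first.
    by rewrite (bigD1 j)//= mj ltr_wpDr// sumr_ge0.
  move=> h; apply: contrapT => no; move: h; rewrite big1 ?ltxx// => j _.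
  by case: eqP => // /eqP mj; case: no; exists j.
rewrite in_label_set; apply/existsP/andP =>
  [[j /eqP ->]|[om /existsP[j /eqP mj]]].
  have [os ls] := siteP s.1 (crd s.2 j); split => //.
  by apply/existsP; exists j; rewrite ls.
by exists j; rewrite mj (site_uniq om erefl).
Qed.

Theorem theorem1p5 (R : realType) (q : R) (hq0 : 0 < q) (hq1 : q < 1)
    (d : nat) (hd : (1 <= d)%N) (c : R)
    (disp : measure_display) (T : measurableType disp) (P : probability T R)
    (S : R -> T -> coupled_state d)
    (hS : markov_jump_process (@coupled_rate R q d) P S)
    (hstat : stationary P S)
    (t : R) (ht : 0 <= t)
    (hxi : blocking_law q c P (fun w => (S t w).1))
    (m : int) :
  P [set w | eta_at (S t w) m < xi_at (S t w) m] =
  ((1 - q ^+ d) * q `^ (c - m%:~R) /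
   ((1 + q `^ (c - m%:~R)) * (1 + q `^ (c + d%:R - m%:~R))))%:E.
Proof.
pose xi w := (S t w).1.
have mxi (A : set Omega) : measurable (xi @^-1` A).
  exact: (mjp_measurable hS [set s | A s.1] ht).
have [g g_inj] := coupled_state_inj d.
have Z0 := subset_sum_gt0 hq0 hq1 d.
have mass0 z : 0 <= config_mass P xi z / fine (subset_sum q d).
  by rewrite divr_ge0 ?config_mass_ge0// ltW.
pose A := [set s : coupled_state d |
  occ s.1 m && (label s.1 m \in label_set s.2)].
have -> : [set w | eta_at (S t w) m < xi_at (S t w) m] = S t @^-1` A.
  by apply/seteqP; split => w /=; rewrite second_class_at.
rewrite (prob_esum P (state_measurable hS ht) A g_inj).
(* The product form of the law separates the configuration from the labels. *)
transitivity (\esum_(z in [set z | occ z m])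
    \esum_(x in [set x : Zplus d | label z m \in label_set x])
      ((config_mass P xi z / fine (subset_sum q d))%:E *
       (label_weight q x)%:E))%E.
  rewrite esum_esum; last first.
    by move=> z x _ _; rewrite -EFinM lee_fin mulr_ge0// ltW// label_weight_gt0.
  have -> : A = [set z | occ z m] `*``
      (fun z => [set x : Zplus d | label z m \in label_set x]).
    apply/seteqP; split => -[z x] /=; first by move=> /andP.
    by move=> [? ?]; apply/andP.
  apply: eq_esum => -[z x] _.
  by rewrite -(point_massE hS ht) (point_mass_product hq0 hq1 hS hstat ht hxi)
    -EFinM mulrAC.
(* The trivial factor with exponent 0 puts the sum in the shape of the moment formula at [r = 0]. *)
transitivity ((fine (subset_sum q d))^-1%:E * \esum_(z in [set z | occ z m])
    ((config_mass P xi z * (q ^+ 0) ^+ label z m)%:E *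
     subset_sum_in q d (label z m)))%E.
  rewrite -esumZl; last 2 first.
  - by rewrite invr_ge0 ltW.
  - by move=> z; rewrite mule_ge0 ?subset_sum_in_ge0// lee_fin
      mulr_ge0 ?config_mass_ge0// expr0 expr1n.
  apply: eq_esum => z _; rewrite esumZl//; last first.
    by move=> x; rewrite lee_fin ltW// label_weight_gt0.
  by rewrite esum_label_weight_in expr0 expr1n mulr1 muleA -EFinM mulrC.
rewrite (esum_occupied_label hq0 hq1 mxi hxi) -EFinM; congr _%:E.
have y0 := fugacity_gt0 c hq0 m.
rewrite big_ord0 divr1 addn0 /density.
(* Shifting [c] by [d] multiplies the fugacity by [q ^+ d]. *)
have -> : q `^ (c + d%:R - m%:~R) = q ^+ d * fugacity q c m.
  rewrite addrAC powRD; last by apply/implyP => _; rewrite gt_eqF.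
  by rewrite mulrC powR_mulrn// ltW.
rewrite -/(fugacity q c m).
have : 0 < 1 + q ^+ d * fugacity q c m.
  by rewrite addr_gt0// mulr_gt0// exprn_gt0.
by move=> f0; field; rewrite !gt_eqF// addr_gt0.
Qed.
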